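(* For a Gauss diagram with $n$ chords, let $M$ be the adjacency matrix of its interlacement graph, with rows $m_i$ indexed by the chords, and consider the following three conditions: (1) $\langle m_i,m_i\rangle\equiv 0 \pmod 2$ for every chord $i$; (2) $\langle m_i,m_j\rangle\equiv 0\pmod 2$ whenever the distinct chords $i$ and $j$ do not intersect; (3) $\langle m_i,m_j\rangle+\langle m_i,m_k\rangle+\langle m_j,m_k\rangle\equiv 1\pmod 2$ whenever the distinct chords $i,j,k$ intersect pairwise. There is exactly one (up to equivalence) Gauss diagram with nine chords which satisfies conditions (1)--(3) but is not realizable. It is the Gauss diagram given by the cyclic double occurrence word $$0\;7\;8\;4\;3\;5\;6\;8\;7\;2\;1\;6\;5\;0\;4\;3\;2\;1.$$ In particular, conditions (1)--(3) are not sufficient for realizability of a Gauss diagram.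
   Context: A Gauss diagram (chord diagram) is a circle with finitely many chords whose endpoints are pairwise distinct; equivalently, it is given by a double occurrence word (each letter occurs exactly twice) written cyclically around the circle, each pair of equal letters being joined by a chord. Gauss diagrams are counted up to equivalence, i.e. up to relabelling of the chords and rotation and reflection of the circle. Gauss diagram of a plane curve: let $\gamma$ be a closed plane curve whose self-intersections are finitely many transversal double points (crossings), with distinct labels. Walking once along $\gamma$ and recording the labels of the crossings in the order they are passed gives a double occurrence word (a Gauss code of $\gamma$); the chord diagram of this word is the Gauss diagram $\mathfrak{G}(\gamma)$. A Gauss diagram $\mathfrak{G}$ is realizable if there is a closed plane curve $\gamma$ of this kind with $\mathfrak{G}=\mathfrak{G}(\gamma)$. The interlacement graph of $\mathfrak{G}$ is the simple graph whose vertices are the chords of $\mathfrak{G}$, two vertices being adjacent if and only if the corresponding chords intersect (i.e. their endpoints alternate on the circle). Its adjacency matrix $M=(m_{i,j})$ has $m_{i,j}=1$ if chords $i\ne j$ intersect and $m_{i,j}=0$ otherwise; $m_i$ denotes the $i$-th row and $\langle m_i,m_j\rangle=\sum_k m_{i,k}m_{j,k}$. *)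

(* Defs.v *)
From HB Require Import structures.
From mathcomp Require Import all_boot all_order all_algebra all_fingroup.
From mathcomp Require Import all_classical all_reals all_analysis.

Set Implicit Arguments.
Unset Strict Implicit.
Unset Printing Implicit Defensive.

Import Order.TTheory GRing.Theory Num.Theory.
Import numFieldNormedType.Exports.

Local Open Scope classical_set_scope.
Local Open Scope ring_scope.

(* A Gauss diagram with n chords is represented by a double occurrence word
   over its set of chords 'I_n, read off along the circle from some base
   point; the independence of the base point, of the orientation of the circle
   and of the names of the chords is expressed by gauss_equiv. *)
Definition double_occurrence (n : nat) (w : seq 'I_n) : Prop :=
  forall i : 'I_n, count_mem i w = 2%N.

Definition gauss_equiv (n : nat) (w w' : seq 'I_n) : Prop :=
  exists (s : 'S_n) (k : nat),
    w' = rot k (map s w) \/ w' = rot k (rev (map s w)).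

(* The endpoints of the chords i and j alternate on the circle. *)
Definition chords_intersect (n : nat) (w : seq 'I_n) (i j : 'I_n) : bool :=
  (i != j) &&
  ([seq x <- w | (x == i) || (x == j)]
     \in [:: [:: i; j; i; j]; [:: j; i; j; i]]).

Definition interlacement_mx (n : nat) (w : seq 'I_n) : 'M[nat]_n :=
  \matrix_(i, j) nat_of_bool (chords_intersect w i j).

Definition row_dot (n : nat) (M : 'M[nat]_n) (i j : 'I_n) : nat :=
  (\sum_(k < n) M i k * M j k)%N.

Definition condition1 (n : nat) (w : seq 'I_n) : Prop :=
  forall i : 'I_n, row_dot (interlacement_mx w) i i = 0 %[mod 2].

Definition condition2 (n : nat) (w : seq 'I_n) : Prop :=
  forall i j : 'I_n, i != j -> ~~ chords_intersect w i j ->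
    row_dot (interlacement_mx w) i j = 0 %[mod 2].

Definition condition3 (n : nat) (w : seq 'I_n) : Prop :=
  forall i j k : 'I_n,
    chords_intersect w i j -> chords_intersect w i k ->
    chords_intersect w j k ->
    (row_dot (interlacement_mx w) i j + row_dot (interlacement_mx w) i k
       + row_dot (interlacement_mx w) j k)%N = 1 %[mod 2].

(* Closed plane curves are 1-periodic continuous maps R -> R^2; each point of
   the circle has exactly one parameter t with 0 <= t < 1. *)
Definition closed_plane_curve (R : realType) (g : R -> R * R) : Prop :=
  continuous g /\ forall t : R, g (t + 1) = g t.

Definition crossings (R : realType) (g : R -> R * R) : set (R * R) :=
  [set p | exists s t : R, [/\ 0 <= s < 1, 0 <= t < 1, s != t, g s = p & g t = p]].

(* The curve has a velocity at both of the parameters s and t, and the two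
   velocities are linearly independent. *)
Definition transversal_at (R : realType) (g : R -> R * R) (s t : R) : Prop :=
  exists u v : R * R,
    [/\ is_derive s 1 (fst \o g) u.1, is_derive s 1 (snd \o g) u.2,
        is_derive t 1 (fst \o g) v.1, is_derive t 1 (snd \o g) v.2 &
        u.1 * v.2 - u.2 * v.1 != 0].

(* A closed plane curve whose self-intersections are finitely many transversal
   double points.  Regularity is only imposed where transversality needs it. *)
Definition generic_curve (R : realType) (g : R -> R * R) : Prop :=
  [/\ closed_plane_curve g,
      finite_set (crossings g),
      forall r s t : R, 0 <= r < 1 -> 0 <= s < 1 -> 0 <= t < 1 ->
        g r = g s -> g r = g t -> [\/ r = s, r = t | s = t] &
      forall s t : R, 0 <= s < 1 -> 0 <= t < 1 -> s != t ->
        g s = g t -> transversal_at g s t].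

(* The bijection c from 'I_n onto the set of crossings names the crossings by
   distinct labels, ts lists in increasing order the parameters at which the
   curve passes a crossing, and w is the word of the labels met. *)
Definition gauss_code (R : realType) (n : nat) (g : R -> R * R)
    (w : seq 'I_n) : Prop :=
  exists (c : 'I_n -> R * R) (ts : seq R),
    [/\ injective c, range c = crossings g,
        sorted <%R ts,
        forall t : R, t \in ts <-> 0 <= t < 1 /\ crossings g (g t) &
        [seq g t | t <- ts] = [seq c i | i <- w]].

Definition realizable (R : realType) (n : nat) (w : seq 'I_n) : Prop :=
  exists (g : R -> R * R) (w' : seq 'I_n),
    [/\ generic_curve g, gauss_code g w' & gauss_equiv w w'].

Definition exceptional_word : seq 'I_9 :=
  [seq inord k | k <- [:: 0; 7; 8; 4; 3; 5; 6; 8; 7; 2; 1; 6; 5; 0; 4; 3; 2; 1]%N].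

(* Main.v *)
Require Import Defs.
From mathcomp Require Import all_boot all_order all_algebra all_fingroup.
From mathcomp Require Import all_classical all_reals all_analysis.
From mathcomp Require Import ring lra zify.
Import Order.TTheory GRing.Theory Num.Theory.
Import numFieldNormedType.Exports.
Set Implicit Arguments.
Unset Strict Implicit.
Unset Printing Implicit Defensive.
Local Open Scope classical_set_scope.
Local Open Scope ring_scope.

(** The theorem has two halves, one topological obstruction and one finite
    search whose hits are drawn in the plane.

    Why the exceptional diagram is not realizable.  On a curve with this Gauss
    diagram the arcs 4 3 5 (positions 3 to 5) and 5 0 4 (positions 12 to 14)
    have the same two end points and close up to a loop P; likewise the arcs
    7 2 1 (positions 8 to 10) and 1 0 7 (positions 17 to 19, counted modulo 18)
    close up to a loop Q.  The only letter that occurs both on P and on Q is 0,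
    so the two closed curves meet exactly once, and transversally.  This is impossible, because two closed curves in the
    plane cross an even number of times (single_transversal_meeting).  The
    parity argument is combinatorial: sample the difference P s - Q t on a grid
    of the torus and add up over the cells the number of times, modulo 2, that
    the boundary of the cell crosses the negative first axis.  The total is 0
    since every edge is counted twice, a cell whose values lie in an open half
    plane contributes 0, and the one cell around the transversal zero
    contributes 1.

    Why every other diagram that satisfies the conditions is realizable.  A word
    is encoded by its list of partners: which position carries the same letter.
    Here condition1 makes the two positions of each letter have opposite parity,
    and up to rotation the chord from position 0 may be taken shortest, so that
    a backtracking search over the pairings of 18 positions visits all cases.
    For each visited pairing that satisfies the conditions, other than the
    exceptional one, the search runs Dehn's algorithm: reversing, for each
    letter, the segment between its two passages splits every crossing so that
    the curve becomes a simple closed curve that touches itself at the former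
    crossings; the touching points are joined by arches drawn on the two sides
    of this curve, and the test is that the arches can be distributed on the two
    sides without crossings.  Such a picture is turned into a closed curve on
    the integer lattice (arch_diagram_realizable): the simple closed curve is
    laid along the horizontal axis, and each letter becomes a pair of parallel
    arches, shifted against each other so that they cross exactly once.

    The halves are exceptional_not_realizable and realizable_or_exceptional; they
    combine because the conditions and realizability are invariant under
    relabelling, rotation and reflection. *)

(** * Crossing parity of sampled closed curves *)

Section Parity.
Variable R : realType.
Implicit Types z w : R * R.

(** Whether the segment from z to w crosses the negative first axis; counting a
    point of the axis itself with the upper half plane makes the parity of the
    number of cuts along a closed polygon equal to that of its winding number. *)
Definition cuts z w : bool :=
  let det := z.1 * w.2 - z.2 * w.1 in
  if 0 <= z.2 then (w.2 < 0) && (0 < det) else (0 <= w.2) && (det < 0).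

(** The winding parity around the origin of the boundary of one cell of a grid. *)
Definition cell_parity (f : nat -> nat -> R * R) k l : bool :=
  cuts (f k l) (f k.+1 l) (+) cuts (f k l.+1) (f k.+1 l.+1)
  (+) (cuts (f k l) (f k l.+1) (+) cuts (f k.+1 l) (f k.+1 l.+1)).

Lemma telescope_addb n (u : nat -> bool) :
  \big[addb/false]_(k < n) (u k (+) u k.+1) = u 0%N (+) u n.
Proof.
elim: n => [|n IHn]; first by rewrite big_ord0 addbb.
by rewrite big_ord_recr /= IHn addbA addbK.
Qed.

(** On a torus every edge of the grid borders two cells, so it cancels. *)
Lemma cell_parity_sum (P Q : nat -> R * R) m n : P m = P 0%N -> Q n = Q 0%N ->
  \big[addb/false]_(k < m) \big[addb/false]_(l < n)
     cell_parity (fun i j => P i - Q j) k l = false.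
Proof.
move=> Pm Qn; pose F i j := P i - Q j.
under eq_bigr => k _ do rewrite big_split /=.
rewrite big_split /= big1 /=; last first.
  move=> k _; rewrite (telescope_addb _ (fun l => cuts (F k l) (F k.+1 l))).
  by rewrite /F Qn addbb.
rewrite exchange_big /= big1 // => l _.
rewrite (telescope_addb _ (fun k => cuts (F k l) (F k l.+1))).
by rewrite /F Pm addbb.
Qed.

(** Inside an open half plane a cut only depends on the two signs of the second
    coordinate, whence cuts cancel around a closed polygon. *)
Lemma cuts_half_plane a b z w :
  0 < a * z.1 + b * z.2 -> 0 < a * w.1 + b * w.2 ->
  cuts z w = (a < 0) && ((0 <= z.2) (+) (0 <= w.2)).
Proof.
rewrite /cuts; case: z w => [x y] [x' y'] /= hz hw.
have [a0|a0] := ltP a 0 => /=.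
- case: (leP 0 y) => hy; case: (leP 0 y') => hy' //=.
  + by nra.
  + by nra.
- case: (leP 0 y) => hy; case: (leP 0 y') => hy' //=.
  + by apply/negbTE; rewrite -leNgt; nra.
  + by apply/negbTE; rewrite -leNgt; nra.
Qed.

Lemma cell_parity_half_plane f k l a b :
  (forall i j, (k <= i <= k.+1)%N -> (l <= j <= l.+1)%N ->
     0 < a * (f i j).1 + b * (f i j).2) ->
  cell_parity f k l = false.
Proof.
move=> h; have := conj (h k l) (conj (h k l.+1) (conj (h k.+1 l) (h k.+1 l.+1))).
rewrite !leqnn !leqnSn => -[/(_ isT isT) h1 [/(_ isT isT) h2]].
move=> [/(_ isT isT) h3 /(_ isT isT) h4].
rewrite /cell_parity !(cuts_half_plane (a := a) (b := b)) //.
by case: (a < 0) => //=; do 4 case: (0 <= _).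
Qed.

Lemma cell_parity_origin f k l :
  (f k l).1 < 0 -> (f k l).2 < 0 ->
  0 < (f k.+1 l).1 -> (f k.+1 l).2 < 0 ->
  0 < (f k.+1 l.+1).1 -> 0 < (f k.+1 l.+1).2 ->
  (f k l.+1).1 < 0 -> 0 < (f k l.+1).2 ->
  cell_parity f k l = true.
Proof.
rewrite /cell_parity /cuts.
case: (f k l) (f k.+1 l) (f k l.+1) (f k.+1 l.+1) => [a b] [c d] [x y] [z t] /=.
move=> ha hb hc hd hz ht hx hy.
rewrite (lt_geF hb) (lt_geF hd) (ltW hy) (ltW ht) /=.
rewrite (lt_gtF ht) /=.
have -> : a * y - b * x < 0 by nra.
by have -> : (c * t - d * z < 0) = false by apply/negbTE; rewrite -leNgt; nra.
Qed.

(** A partition of [A, B] of mesh at most d, except for one prescribed interval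
    of radius e around a; the proof subdivides the two sides uniformly. *)
Lemma nested_partition (A B a e d : R) : A < a - e -> a + e < B -> 0 < e -> 0 < d ->
  exists (x : nat -> R) (m k0 : nat),
    [/\ x 0%N = A /\ x m = B, (k0 < m)%N, x k0 = a - e, x k0.+1 = a + e &
      forall k, (k < m)%N -> [/\ A <= x k <= B, k != k0 -> x k <= x k.+1 <= x k + d &
        k != k0 -> x k.+1 <= a - e \/ a + e <= x k]].
Proof.
move=> hA hB he hd.
have [N hN] : exists N : nat, (B - A) / d <= N.+1%:R.
  have h0 : 0 <= (B - A) / d by apply: divr_ge0; lra.
  exists (Num.bound ((B - A) / d)).
  by apply: le_trans (ltW (archi_boundP h0)) _; rewrite ler_nat.
pose h1 := (a - e - A) / N.+1%:R; pose h2 := (B - a - e) / N.+1%:R.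
have N0 : (0 : R) < N.+1%:R by rewrite ltr0n.
have hBA : B - A <= d * N.+1%:R by rewrite mulrC -ler_pdivrMr.
have h1d : 0 <= h1 <= d.
  by rewrite /h1 ler_pdivrMr // divr_ge0 ?(ltW N0) //=; lra.
have h2d : 0 <= h2 <= d.
  by rewrite /h2 ler_pdivrMr // divr_ge0 ?(ltW N0) //=; lra.
have e1 : h1 * N.+1%:R = a - e - A by rewrite /h1 divfK ?gt_eqF.
have e2 : h2 * N.+1%:R = B - a - e by rewrite /h2 divfK ?gt_eqF.
exists (fun k => if (k <= N.+1)%N then A + k%:R * h1
                 else a + e + (k - N.+2)%:R * h2).
exists (N.+1 + N.+2)%N, N.+1; split.
- split; first by rewrite /= mul0r addr0.
  rewrite ifF ?addnK ?(mulrC _ h2) ?e2; first by lra.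
  by apply/negbTE; rewrite -ltnNge addnS ltnS leq_addr.
- by rewrite addnS ltnS leq_addr.
- by rewrite leqnn mulrC e1; lra.
- by rewrite ltnn subnn mul0r addr0.
move=> k hk; case: (leqP k N.+1) => hkN.
- have hk1 : k%:R * h1 <= a - e - A.
    by rewrite -e1 mulrC ler_wpM2l ?ler_nat //; lra.
  have hk0 : 0 <= k%:R * h1 by apply: mulr_ge0; [exact: ler0n | lra].
  have kN' : k != N.+1 -> (k < N.+1)%N by move=> kN; rewrite ltn_neqAle kN.
  split=> [|/kN' kN|/kN' kN]; first by lra.
    by rewrite kN -[k.+1%:R]natr1 mulrDl mul1r; lra.
  rewrite kN; left.
  have : k.+1%:R * h1 <= a - e - A.
    by rewrite -e1 mulrC ler_wpM2l ?ler_nat //; lra.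
  by lra.
- rewrite [(k.+1 <= _)%N]leqNgt ltnS (ltnW hkN) /= subSn //.
  have hk1 : (k - N.+2)%:R * h2 <= B - a - e.
    rewrite -e2 mulrC ler_wpM2l ?ler_nat //; first by lra.
    by rewrite leq_subLR addnC ltnW.
  have hk0 : 0 <= (k - N.+2)%:R * h2 by apply: mulr_ge0; [exact: ler0n | lra].
  by split; [lra | move=> _; rewrite -natr1 mulrDl mul1r; lra | move=> _; right; lra].
Qed.

End Parity.

Section HalfPlanes.
Variable R : realType.

(** A uniform scale at which a nowhere vanishing planar map stays in a half
    plane: near each point some linear functional is positive, and compactness
    makes the radius uniform. *)
Lemma half_plane_compact (K : set (R * R)) (f1 f2 : R * R -> R) :
  compact K -> continuous f1 -> continuous f2 ->
  (forall p, K p -> f1 p != 0 \/ f2 p != 0) ->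
  exists2 d, 0 < d & forall p, K p -> exists a b, forall q,
    `|q.1 - p.1| <= d -> `|q.2 - p.2| <= d -> 0 < a * f1 q + b * f2 q.
Proof.
move=> /compact_near_coveringP cK c1 c2 nz.
pose G (d : R) (p : R * R) := exists a b, forall q,
    `|q.1 - p.1| <= d -> `|q.2 - p.2| <= d -> 0 < a * f1 q + b * f2 q.
suff : \forall d \near 0^'+, K `<=` G d.
  move=> h; have [d [d0 hd]] := filter_ex (filterI (nbhs_right_gt (0 : R)) h).
  by exists d.
apply: cK => p /nz hp.
have [a [b hab]] : exists a b, 0 < a * f1 p + b * f2 p.
  case: hp => [/lt_total|/lt_total] /orP[h|h];
   [exists (-1), 0|exists 1, 0|exists 0, (-1)|exists 0, 1]; lra.
have cab : {for p, continuous (fun q => a * f1 q + b * f2 q)}.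
  by apply: cvgD; apply: cvgM; first [exact: cvg_cst|exact: c1|exact: c2].
have := cab _ (lt_nbhsr hab); rewrite nbhs_simpl /= => /nbhs_ballP[e /= e0 he].
have e20 : 0 < e / 2 by lra.
exists ([set q | ball p (e / 2) q], [set d | d < e / 2]).
  by split => /=; [exact: (near_ball p _ e20) | exact: nbhs_right_lt].
move=> [q d] /= [[q1 q2] dlt]; exists a, b => r r1 r2; apply: he.
move: q1 q2; rewrite /ball /= /prod_ball /= /ball /= => q1 q2.
split => /=.
  have -> : p.1 - r.1 = (p.1 - q.1) - (r.1 - q.1) by ring.
  by apply: le_lt_trans (ler_normB _ _) _; lra.
have -> : p.2 - r.2 = (p.2 - q.2) - (r.2 - q.2) by ring.
by apply: le_lt_trans (ler_normB _ _) _; lra.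
Qed.

End HalfPlanes.

(** * Two closed curves cannot meet exactly once and transversally *)

Section SingleMeeting.
Variable R : realType.

Lemma pair_nat_eq k i : (k <= i <= k.+1)%N -> i = k \/ i = k.+1.
Proof. by lia. Qed.

(** The relative error 1/4 is small enough to preserve the signs of the
    coordinates at the corners of a square centred at 0. *)
Definition close_to (z : R * R) (u v : R) :=
  `|z.1 - u| <= (`|u| + `|v|) / 4 /\ `|z.2 - v| <= (`|u| + `|v|) / 4.

(** Both ends of an interval lie on the same side of the gap from - e to e. *)
Definition on_side (e x x' : R) := (x <= - e /\ x' <= - e) \/ (e <= x /\ e <= x').

Lemma cell_parity_center (F : nat -> nat -> R * R) k l e : 0 < e ->
  close_to (F k l) (- e) (- e) -> close_to (F k.+1 l) e (- e) ->
  close_to (F k l.+1) (- e) e -> close_to (F k.+1 l.+1) e e ->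
  cell_parity F k l.
Proof.
move=> e0; rewrite /close_to !normrN !(gtr0_norm e0) !ler_norml.
have -> : (e + e) / 4 = e / 2 by lra.
move=> [/andP[a1 a2] /andP[a3 a4]] [/andP[b1 b2] /andP[b3 b4]].
move=> [/andP[c1 c2] /andP[c3 c4]] [/andP[d1 d2] /andP[d3 d4]].
apply: cell_parity_origin.
- by clear -a1 a2 e0; lra.
- by clear -a3 a4 e0; lra.
- by clear -b1 b2 e0; lra.
- by clear -b3 b4 e0; lra.
- by clear -d1 d2 e0; lra.
- by clear -d3 d4 e0; lra.
- by clear -c1 c2 e0; lra.
- by clear -c3 c4 e0; lra.
Qed.

Lemma close_toP z u v : close_to z u v -> [/\ u - (`|u| + `|v|) / 4 <= z.1,
   z.1 <= u + (`|u| + `|v|) / 4, v - (`|u| + `|v|) / 4 <= z.2 &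
   z.2 <= v + (`|u| + `|v|) / 4].
Proof. by rewrite /close_to !ler_norml => -[/andP[? ?] /andP[? ?]]; split; lra. Qed.

(** A cell of the linearized difference that misses the central one lies in a
    half plane bounded by an axis or by a diagonal. *)
Lemma cell_parity_side (F : nat -> nat -> R * R) k l e (u v : nat -> R) : 0 < e ->
  (forall i j, (k <= i <= k.+1)%N -> (l <= j <= l.+1)%N ->
     close_to (F i j) (u i) (v j)) ->
  [\/ (`|u k| = e /\ `|u k.+1| = e) /\ on_side e (v l) (v l.+1),
      on_side e (u k) (u k.+1) /\ (`|v l| = e /\ `|v l.+1| = e) |
      on_side e (u k) (u k.+1) /\ on_side e (v l) (v l.+1)] ->
  cell_parity F k l = false.
Proof.
move=> e0 hF.
have side (w : nat -> R) m : on_side e (w m) (w m.+1) ->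
    exists2 s, s = 1 \/ s = -1 &
      forall i, (m <= i <= m.+1)%N -> `|w i| = s * w i /\ e <= s * w i.
  move=> [[h1 h2]|[h1 h2]]; [exists (-1); first by right | exists 1; first by left];
    move=> i /pair_nat_eq[->|->]; split; try lra.
  - by rewrite ler0_norm; lra.
  - by rewrite ler0_norm; lra.
  - by rewrite ger0_norm; lra.
  - by rewrite ger0_norm; lra.
have central (w : nat -> R) m i : `|w m| = e /\ `|w m.+1| = e ->
   (m <= i <= m.+1)%N -> `|w i| = e by move=> [? ?] /pair_nat_eq[->|->].
move=> [[hu /side[t ht hv]]|[/side[s hs hu] hv]|[/side[s hs hu] /side[t ht hv]]].
- apply: (@cell_parity_half_plane _ _ _ _ 0 t) => i j hi hj.
  have [f1 f2 f3 f4] := close_toP (hF _ _ hi hj).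
  have := central _ _ _ hu hi; have [v1 v2] := hv _ hj; move=> hui.
  rewrite hui v1 in f1 f2 f3 f4.
  by case: ht => ht; rewrite ht in f1 f2 f3 f4 v2 *; clear -f3 f4 v2 e0; lra.
- apply: (@cell_parity_half_plane _ _ _ _ s 0) => i j hi hj.
  have [f1 f2 f3 f4] := close_toP (hF _ _ hi hj).
  have := central _ _ _ hv hj; have [v1 v2] := hu _ hi; move=> hui.
  rewrite hui v1 in f1 f2 f3 f4.
  by case: hs => hs; rewrite hs in f1 f2 f3 f4 v2 *; clear -f1 f2 v2 e0; lra.
- apply: (@cell_parity_half_plane _ _ _ _ s t) => i j hi hj.
  have [f1 f2 f3 f4] := close_toP (hF _ _ hi hj).
  have [v1 v2] := hv _ hj; have [u1 u2] := hu _ hi.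
  rewrite u1 v1 in f1 f2 f3 f4.
  by case: hs => hs; case: ht => ht; rewrite hs ht in f1 f2 f3 f4 u2 v2 *;
    clear -f1 f2 f3 f4 u2 v2 e0; lra.
Qed.

(** Near the meeting point the first curve follows the first axis and the second
    one the second axis downwards, so that P (a + h) - Q (b + k) is close to
    (h, k).  Far from the meeting point half_plane_compact applies, near it the
    linearization does, and only the central cell has odd parity. *)
Lemma single_meeting_normalized (P Q : R -> R * R) (A a B C b D r : R) (p : R * R) :
  continuous (fun s => (P s).1) -> continuous (fun s => (P s).2) ->
  continuous (fun s => (Q s).1) -> continuous (fun s => (Q s).2) ->
  A < a < B -> C < b < D -> P A = P B -> Q C = Q D ->
  (forall s t, A <= s <= B -> C <= t <= D -> P s = Q t -> s = a /\ t = b) ->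
  0 < r ->
  (forall h, `|h| <= r -> `|(P (a + h)).1 - p.1 - h| <= `|h| / 4 /\
                          `|(P (a + h)).2 - p.2| <= `|h| / 4) ->
  (forall h, `|h| <= r -> `|(Q (b + h)).1 - p.1| <= `|h| / 4 /\
                          `|(Q (b + h)).2 - p.2 + h| <= `|h| / 4) ->
  False.
Proof.
move=> cP1 cP2 cQ1 cQ2 hA hC PAB QCD meet r0 nearP nearQ.
pose f1 (q : R * R) := (P q.1).1 - (Q q.2).1.
pose f2 (q : R * R) := (P q.1).2 - (Q q.2).2.
(* The parameters far from the meeting point, on which P - Q vanishes nowhere. *)
pose K : set (R * R) := (`[A, B] `*` `[C, D]) `&`
  ([set q | r / 2 <= `|q.1 - a|] `|` [set q | r / 2 <= `|q.2 - b|]).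
have cK : compact K.
  apply: compact_closedI.
    by apply: compact_setX; exact: segment_compact.
  have cl (g : R * R -> R) : continuous g -> closed [set q | r / 2 <= `|g q| ].
    move=> cg; rewrite (_ : [set q | _] = (fun q => `|g q|) @^-1` [set x | r / 2 <= x]) //.
    apply: closed_comp; last exact: closed_ge.
    by move=> q _; apply: continuous_comp; [exact: cg | exact: norm_continuous].
  apply: closedU; apply: cl => q; apply: cvgB; try exact: cvg_cst.
    exact: cvg_fst.
  exact: cvg_snd.
have cf1 : continuous f1.
  move=> q; apply: cvgB.
    by apply: (@continuous_comp _ _ _ fst (fun s => (P s).1)); [exact: cvg_fst | exact: cP1].
  by apply: (@continuous_comp _ _ _ snd (fun s => (Q s).1)); [exact: cvg_snd | exact: cQ1].
have cf2 : continuous f2.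
  move=> q; apply: cvgB.
    by apply: (@continuous_comp _ _ _ fst (fun s => (P s).2)); [exact: cvg_fst | exact: cP2].
  by apply: (@continuous_comp _ _ _ snd (fun s => (Q s).2)); [exact: cvg_snd | exact: cQ2].
have nz q : K q -> f1 q != 0 \/ f2 q != 0.
  case: q => s t [[/= + +]]; rewrite /= !in_itv /= => hs ht hfar.
  apply/orP; rewrite -negb_and; apply/negP => /andP[].
  rewrite /f1 /f2 /= !subr_eq0 => /eqP e1 /eqP e2.
  have /(meet _ _ hs ht)[sa tb] : P s = Q t.
    by rewrite [P s]surjective_pairing e1 e2 -surjective_pairing.
  by case: hfar => /=; rewrite ?sa ?tb subrr normr0; lra.
have [d0 d00 hd0] := half_plane_compact cK cf1 cf2 nz.
pose d := Num.min d0 (r / 2).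
have [d_gt0 dd0 dr] : [/\ 0 < d, d <= d0 & d <= r / 2].
  by rewrite /d lt_min d00 !ge_min !lexx orbT; split => //=; lra.
(* The radius of the central cell: it fits in the rectangle, and its sides 2 e are
   at most d. *)
pose e := Num.min (d / 2) (Num.min (Num.min ((a - A) / 2) ((B - a) / 2))
                                   (Num.min ((b - C) / 2) ((D - b) / 2))).
have [e0 ed [eA eB eC eD]] : [/\ 0 < e, e <= d / 2 &
   [/\ e <= (a - A) / 2, e <= (B - a) / 2, e <= (b - C) / 2 & e <= (D - b) / 2]].
  rewrite /e !lt_min !ge_min !lexx !orbT; split => //=.
  by repeat (apply/andP; split); lra.
have [hA1 hA2 hC1 hC2] : [/\ A < a - e, a + e < B, C < b - e & b + e < D].
  by clear -hA hC eA eB eC eD e0; split; lra.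
have [x [m [k0 [[x0 xm] k0m xk xk1 hx]]]] := nested_partition hA1 hA2 e0 d_gt0.
have [y [n [l0 [[y0 yn] l0n yl yl1 hy]]]] := nested_partition hC1 hC2 e0 d_gt0.
have stepx k : (k < m)%N -> x k <= x k.+1 <= x k + d.
  by move=> /hx[_ h _]; have [->|/h//] := eqVneq k k0; rewrite xk xk1; clear -e0 ed; lra.
have stepy l : (l < n)%N -> y l <= y l.+1 <= y l + d.
  by move=> /hy[_ h _]; have [->|/h//] := eqVneq l l0; rewrite yl yl1; clear -e0 ed; lra.
pose F i j := P (x i) - Q (y j); pose u i := x i - a; pose v j := y j - b.
have near_est i j : `|u i| <= r -> `|v j| <= r -> close_to (F i j) (u i) (v j).
  rewrite /u /v => hi hj; have [p1 p2] := nearP _ hi; have [q1 q2] := nearQ _ hj.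
  move: p1 p2 q1 q2; rewrite !subrKC => p1 p2 q1 q2.
  rewrite /F; split.
    have -> : (P (x i) - Q (y j)).1 - (x i - a) =
      ((P (x i)).1 - p.1 - (x i - a)) - ((Q (y j)).1 - p.1) by rewrite /=; ring.
    by apply: le_trans (ler_normB _ _) _; rewrite mulrDl lerD.
  have -> : (P (x i) - Q (y j)).2 - (y j - b) =
    ((P (x i)).2 - p.2) - ((Q (y j)).2 - p.2 + (y j - b)) by rewrite /=; ring.
  by apply: le_trans (ler_normB _ _) _; rewrite mulrDl lerD.
have [uk uk1] : u k0 = - e /\ u k0.+1 = e by rewrite /u xk xk1; split; ring.
have [vl vl1] : v l0 = - e /\ v l0.+1 = e by rewrite /v yl yl1; split; ring.
have eN : `|- e| = e by rewrite normrN gtr0_norm.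
have eP : `|e| = e by rewrite gtr0_norm.
have er : e <= r by clear -ed dr r0; lra.
have central : cell_parity F k0 l0.
  apply: (cell_parity_center e0).
  - by have := near_est k0 l0; rewrite uk vl eN; apply.
  - by have := near_est k0.+1 l0; rewrite uk1 vl eN eP; apply.
  - by have := near_est k0 l0.+1; rewrite uk vl1 eN eP; apply.
  - by have := near_est k0.+1 l0.+1; rewrite uk1 vl1 eP; apply.
(* Off the centre a cell is far from the meeting point or in the linear zone. *)
have other k l : (k < m)%N -> (l < n)%N -> ~~ ((k == k0) && (l == l0)) ->
    cell_parity F k l = false.
  move=> km ln kl.
  have [xAB xs xo] := hx _ km; have [yCD ys yo] := hy _ ln.
  have xS := stepx _ km; have yS := stepy _ ln.
  have dx i : (k <= i <= k.+1)%N -> `|x i - x k| <= d.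
    move=> /pair_nat_eq[->|->]; first by rewrite subrr normr0 ltW.
    by rewrite ger0_norm; clear -xS; lra.
  have dy j : (l <= j <= l.+1)%N -> `|y j - y l| <= d.
    move=> /pair_nat_eq[->|->]; first by rewrite subrr normr0 ltW.
    by rewrite ger0_norm; clear -yS; lra.
  have [/orP far|] := boolP ((r / 2 <= `|x k - a|) || (r / 2 <= `|y l - b|)).
    have [|al [be hab]] := hd0 (x k, y l).
      by split; [split; rewrite /= in_itv | exact: far].
    apply: (@cell_parity_half_plane _ _ _ _ al be) => i j /dx hi /dy hj.
    by apply: (hab (x i, y j)) => /=; apply: le_trans dd0.
  rewrite negb_or -!ltNge => /andP[nu nv].
  have sx : k != k0 -> on_side e (u k) (u k.+1).
    move=> /[dup] /xs + /xo; rewrite /on_side /u; clear -xS.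
    by move=> h [h1|h1]; [left|right]; split; lra.
  have sy : l != l0 -> on_side e (v l) (v l.+1).
    move=> /[dup] /ys + /yo; rewrite /on_side /v; clear -yS.
    by move=> h [h1|h1]; [left|right]; split; lra.
  apply: (@cell_parity_side _ _ _ e u v) => //.
    move=> i j /dx hi /dy hj; apply: near_est; rewrite /u /v.
      have -> : x i - a = (x i - x k) + (x k - a) by ring.
      by apply: le_trans (ler_normD _ _) _; clear -hi nu dr; lra.
    have -> : y j - b = (y j - y l) + (y l - b) by ring.
    by apply: le_trans (ler_normD _ _) _; clear -hj nv dr; lra.
  have [kk|/sx hu] := eqVneq k k0; have [ll|/sy hv] := eqVneq l l0.
  - by rewrite kk ll !eqxx in kl.
  - by apply: Or31; rewrite kk uk uk1 eN eP.
  - by apply: Or32; rewrite ll vl vl1 eN eP.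
  - by apply: Or33.
have := @cell_parity_sum R (P \o x) (Q \o y) m n.
rewrite /= x0 xm y0 yn => /(_ (esym PAB) (esym QCD)).
rewrite (bigD1 (Ordinal k0m)) //= (bigD1 (Ordinal l0n)) //=.
rewrite [cell_parity _ k0 l0]central.
rewrite big1 => [|l ll0]; last first.
  by apply: other => //=; apply: contra ll0 => /andP[_ /eqP h]; apply/eqP/val_inj.
rewrite big1 // => k kk0; apply: big1 => l _.
by apply: other => //=; apply: contra kk0 => /andP[/eqP h _]; apply/eqP/val_inj.
Qed.

End SingleMeeting.

Section TransversalMeeting.
Variable R : realType.

(** Differentiability as a linear estimate on a closed interval. *)
Lemma is_derive_approx (f : R -> R) (a d e : R) : is_derive a 1 f d -> 0 < e ->
  exists2 r, 0 < r & forall h, `|h| <= r -> `|f (a + h) - f a - h * d| <= `|h| * e.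
Proof.
move=> [df <-] e0; have := derivable_nbhs df.
move=> /eqaddoP/(_ e e0)/nbhs_ballP[r /= r0 hr].
exists (r / 2); first by rewrite divr_gt0.
move=> h hh; have /hr : ball 0 r h.
  by rewrite /ball /= sub0r normrN; clear -hh r0; lra.
rewrite /= mulrC !fctE /= [h *: 1]mulr1 [h + a]addrC opprD addrA.
by [].
Qed.

(** The linear map T sends the velocities u and v of the two curves to (1, 0) and
    (0, -1), which reduces to the normalized position. *)
Lemma single_transversal_meeting (P Q : R -> R * R) (A a B C b D : R) (u v : R * R) :
  continuous P -> continuous Q ->
  A < a < B -> C < b < D -> P A = P B -> Q C = Q D -> P a = Q b ->
  (forall s t, A <= s <= B -> C <= t <= D -> P s = Q t -> s = a /\ t = b) ->
  is_derive a 1 (fst \o P) u.1 -> is_derive a 1 (snd \o P) u.2 ->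
  is_derive b 1 (fst \o Q) v.1 -> is_derive b 1 (snd \o Q) v.2 ->
  u.1 * v.2 - u.2 * v.1 != 0 -> False.
Proof.
move=> cP cQ hA hC PAB QCD Pab meet dP1 dP2 dQ1 dQ2.
set det := _ - _ => det0.
pose T (z : R * R) : R * R :=
  ((z.1 * v.2 - z.2 * v.1) / det, (z.1 * u.2 - z.2 * u.1) / det).
have T_inj : injective T.
  move=> [x y] [x' y'] /= [/(mulIf (invr_neq0 det0)) e1 /(mulIf (invr_neq0 det0)) e2].
  have ex : (x - x') * det = 0.
    transitivity (u.1 * (x * v.2 - y * v.1 - (x' * v.2 - y' * v.1)) -
                  v.1 * (x * u.2 - y * u.1 - (x' * u.2 - y' * u.1))).
      by rewrite /det; ring.
    by rewrite e1 e2 !subrr !mulr0 subr0.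
  have ey : (y - y') * det = 0.
    transitivity (u.2 * (x * v.2 - y * v.1 - (x' * v.2 - y' * v.1)) -
                  v.2 * (x * u.2 - y * u.1 - (x' * u.2 - y' * u.1))).
      by rewrite /det; ring.
    by rewrite e1 e2 !subrr !mulr0 subr0.
  move/eqP: ex; move/eqP: ey; rewrite !mulf_eq0 (negPf det0) !orbF !subr_eq0.
  by move=> /eqP -> /eqP ->.
have cT1 (f : R -> R * R) (al be : R) : continuous f ->
    continuous (fun s => ((f s).1 * al - (f s).2 * be) / det).
  move=> cf s; apply: cvgM; last exact: cvg_cst.
  apply: cvgB; apply: cvgM; try exact: cvg_cst.
    by apply: (@continuous_comp _ _ _ f fst); [exact: cf | exact: cvg_fst].
  by apply: (@continuous_comp _ _ _ f snd); [exact: cf | exact: cvg_snd].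
have dT (f : R -> R * R) (c : R) (w : R * R) (al be : R) :
    is_derive c 1 (fst \o f) w.1 -> is_derive c 1 (snd \o f) w.2 ->
    is_derive c 1 (fun s : R => ((f s).1 * al - (f s).2 * be) / det)
                  ((w.1 * al - w.2 * be) / det).
  move=> d1 d2.
  rewrite (_ : (fun _ => _) = (al / det) *: (fst \o f) - (be / det) *: (snd \o f)); last first.
    by apply/funext => s; rewrite !fctE /= /GRing.scale /=; ring.
  by apply: is_derive_eq; rewrite /GRing.scale /=; ring.
have q0 : (0 : R) < 1 / 4 by lra.
have [r1 r10 h1] := is_derive_approx (dT _ _ _ v.2 v.1 dP1 dP2) q0.
have [r2 r20 h2] := is_derive_approx (dT _ _ _ u.2 u.1 dP1 dP2) q0.
have [r3 r30 h3] := is_derive_approx (dT _ _ _ v.2 v.1 dQ1 dQ2) q0.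
have [r4 r40 h4] := is_derive_approx (dT _ _ _ u.2 u.1 dQ1 dQ2) q0.
pose r := Num.min (Num.min r1 r2) (Num.min r3 r4).
have [r0 [rr1 rr2 rr3 rr4]] :
    0 < r /\ [/\ r <= r1, r <= r2, r <= r3 & r <= r4].
  by rewrite /r !lt_min r10 r20 r30 r40 !ge_min !lexx !orbT.
apply: (@single_meeting_normalized R (T \o P) (T \o Q) A a B C b D r (T (P a))).
- exact: cT1.
- exact: cT1.
- exact: cT1.
- exact: cT1.
- exact: hA.
- exact: hC.
- by rewrite /= PAB.
- by rewrite /= QCD.
- by move=> s t hs ht /T_inj; exact: meet.
- exact: r0.
- move=> h hh; split.
  + have := h1 h (le_trans hh rr1).
    by rewrite /= [X in h * X](_ : _ = 1) ?mulr1 ?mul1r // divff.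
  + have := h2 h (le_trans hh rr2).
    rewrite /= [X in h * X](_ : _ = 0) ?mulr0 ?subr0 ?mul1r //.
    by rewrite [u.2 * _]mulrC subrr mul0r.
- move=> h hh; rewrite Pab; split.
  + have := h3 h (le_trans hh rr3).
    rewrite /= [X in h * X](_ : _ = 0) ?mulr0 ?subr0 ?mul1r //.
    by rewrite [v.2 * _]mulrC subrr mul0r.
  + have := h4 h (le_trans hh rr4).
    rewrite /= [X in h * X](_ : _ = -1) ?mulrN1 ?opprK ?mul1r //.
    by rewrite [v.1 * _]mulrC [v.2 * _]mulrC -opprB mulNr divff.
Qed.

(** The path f1 up to c, then f2; the translation makes it continuous even when
    the two pieces do not match at c. *)
Definition glue_path (c : R) (f1 f2 : R -> R * R) (s : R) :=
  f1 (Num.min s c) + (f2 (Num.max s c) - f2 c).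

Lemma glue_path_continuous c f1 f2 : continuous f1 -> continuous f2 ->
  continuous (glue_path c f1 f2).
Proof.
move=> c1 c2 s; apply: cvgD.
  apply: (@continuous_comp _ _ _ (fun s => Num.min s c) f1); last exact: c1.
  by apply: (@continuous_min R R id (cst c)); [exact: cvg_id | exact: cvg_cst].
apply: cvgB; last exact: cvg_cst.
apply: (@continuous_comp _ _ _ (fun s => Num.max s c) f2); last exact: c2.
by apply: (@continuous_max R R id (cst c)); [exact: cvg_id | exact: cvg_cst].
Qed.

Lemma glue_path_left c f1 f2 s : s <= c -> glue_path c f1 f2 s = f1 s.
Proof. by move=> sc; rewrite /glue_path min_l // max_r // subrr addr0. Qed.

Lemma glue_path_right c f1 f2 s : f1 c = f2 c -> c <= s -> glue_path c f1 f2 s = f2 s.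
Proof. by move=> f12 cs; rewrite /glue_path min_r // max_l // f12 addrC subrK. Qed.

End TransversalMeeting.

(** * The exceptional diagram is not realizable *)

Definition exceptional_letters : seq nat :=
  [:: 0; 7; 8; 4; 3; 5; 6; 8; 7; 2; 1; 6; 5; 0; 4; 3; 2; 1]%N.

(** The word is read periodically so that arcs may run over the base point. *)
Definition exceptional_letter i := nth 0%N exceptional_letters (i %% 18).

Lemma exceptional_loops_meet i j :
  (3 <= i <= 5)%N || (12 <= i <= 14)%N -> (8 <= j <= 10)%N || (17 <= j <= 19)%N ->
  exceptional_letter i = exceptional_letter j -> i = 13%N /\ j = 18%N.
Proof.
move=> hi hj /eqP.
have : all (fun i => all (fun j => (exceptional_letter i == exceptional_letter j) ==>
   ((i == 13%N) && (j == 18%N))) [:: 8; 9; 10; 17; 18; 19]%N) [:: 3; 4; 5; 12; 13; 14]%N.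
  by vm_compute.
move/allP/(_ i); rewrite !inE => /(_ ltac:(lia))/allP/(_ j); rewrite !inE.
by move=> /(_ ltac:(lia))/implyP h /h/andP[/eqP -> /eqP ->].
Qed.

Section Window.
Variable R : realType.

(** The function tm lists the times of consecutive passages through crossings, in a
    window long enough to contain the four arcs that form the two loops. *)
Lemma exceptional_window_absurd (g : R -> R * R) (tm : nat -> R) :
  continuous g ->
  (forall i j, (3 <= i)%N -> (i < j)%N -> (j <= 19)%N -> tm i < tm j) ->
  (forall i j, (3 <= i <= 19)%N -> (3 <= j <= 19)%N ->
     g (tm i) = g (tm j) <-> exceptional_letter i = exceptional_letter j) ->
  (forall s t, tm 3%N <= s <= tm 19%N -> tm 3%N <= t <= tm 19%N -> s != t -> g s = g t ->
     exists i j, [/\ (3 <= i <= 19)%N, (3 <= j <= 19)%N, s = tm i & t = tm j]) ->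
  transversal_at g (tm 13%N) (tm 18%N) -> False.
Proof.
move=> cg incr letters multiple [u [v [du1 du2 dv1 dv2 det0]]].
have lt3_5 : tm 3%N < tm 5%N by apply: incr.
have lt5_8 : tm 5%N < tm 8%N by apply: incr.
have lt8_10 : tm 8%N < tm 10%N by apply: incr.
have lt10_12 : tm 10%N < tm 12%N by apply: incr.
have lt12_13 : tm 12%N < tm 13%N by apply: incr.
have lt13_14 : tm 13%N < tm 14%N by apply: incr.
have lt14_17 : tm 14%N < tm 17%N by apply: incr.
have lt17_18 : tm 17%N < tm 18%N by apply: incr.
have lt18_19 : tm 18%N < tm 19%N by apply: incr.
(* During the unit of time before tm 12 the loop P runs through the arc from tm 3 to
   tm 5 at constant speed, and during the unit of time after tm 19 the loop Q runs
   through the arc from tm 8 to tm 10. *)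
pose fP s := g (tm 3%N + (s - tm 12%N + 1) * (tm 5%N - tm 3%N)).
pose fQ s := g (tm 8%N + (s - tm 19%N) * (tm 10%N - tm 8%N)).
have caff (al be ga : R) : continuous (fun s => g (al + (s - be) * ga)).
  move=> s; apply: (@continuous_comp _ _ _ (fun s => al + (s - be) * ga) g); last exact: cg.
  apply: cvgD; first exact: cvg_cst.
  by apply: cvgM; [apply: cvgB; [exact: cvg_id|exact: cvg_cst] | exact: cvg_cst].
have cfP : continuous fP.
  have -> : fP = fun s => g (tm 3%N + (s - (tm 12%N - 1)) * (tm 5%N - tm 3%N)).
    by apply/funext => s; rewrite /fP opprB addrA [s + 1]addrC [s - _ + 1]addrC addrA.
  exact: caff.
have cfQ : continuous fQ by exact: caff.
pose P := glue_path (tm 12%N) fP g; pose Q := glue_path (tm 19%N) g fQ.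
have cP : continuous P by exact: glue_path_continuous.
have cQ : continuous Q by exact: glue_path_continuous.
have same i j : (3 <= i <= 19)%N -> (3 <= j <= 19)%N ->
    exceptional_letter i = exceptional_letter j -> g (tm i) = g (tm j).
  by move=> hi hj /(letters _ _ hi hj).
have gP : fP (tm 12%N) = g (tm 12%N).
  by rewrite /fP subrr add0r mul1r addrC subrK; apply: same.
have gQ : g (tm 19%N) = fQ (tm 19%N).
  by rewrite /fQ subrr mul0r addr0; apply: same.
have P_right s : tm 12%N <= s -> P s = g s by move=> h; apply: glue_path_right.
have Q_left s : s <= tm 19%N -> Q s = g s by move=> h; apply: glue_path_left.
have P_loop s : tm 12%N - 1 <= s <= tm 14%N -> exists2 s', P s = g s' &
    (tm 12%N <= s' <= tm 14%N /\ s' = s) \/ (tm 3%N <= s' <= tm 5%N).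
  case: (leP (tm 12%N) s) => hs /andP[hs1 hs2].
    by exists s; [exact: P_right | left; rewrite hs hs2].
  exists (tm 3%N + (s - tm 12%N + 1) * (tm 5%N - tm 3%N)).
    by rewrite /P glue_path_left // ltW.
  right; have hx : 0 <= s - tm 12%N + 1 <= 1 by clear -hs hs1; lra.
  have hy : 0 <= tm 5%N - tm 3%N by clear -lt3_5; lra.
  by clear -hx hy; case/andP: hx => h0 h1; apply/andP; split; nra.
have Q_loop t : tm 17%N <= t <= tm 19%N + 1 -> exists2 t', Q t = g t' &
    (tm 17%N <= t' <= tm 19%N /\ t' = t) \/ (tm 8%N <= t' <= tm 10%N).
  case: (leP t (tm 19%N)) => ht /andP[ht1 ht2].
    by exists t; [exact: Q_left | left; rewrite ht ht1].
  exists (tm 8%N + (t - tm 19%N) * (tm 10%N - tm 8%N)).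
    by rewrite /Q glue_path_right // ltW.
  right; have hx : 0 <= t - tm 19%N <= 1 by clear -ht ht2; lra.
  have hy : 0 <= tm 10%N - tm 8%N by clear -lt8_10; lra.
  by clear -hx hy; case/andP: hx => h0 h1; apply/andP; split; nra.
have idx_le i j : (3 <= i <= 19)%N -> (3 <= j <= 19)%N -> tm i <= tm j -> (i <= j)%N.
  move=> /andP[hi1 hi2] /andP[hj1 hj2]; apply: contraTT; rewrite -ltnNge -ltNge => h.
  exact: incr.
have dloc (f h : R -> R) (a d : R) : (\near a, f a = h a) ->
  is_derive a 1 f d -> is_derive a 1 h d by move=> e; exact: near_eq_is_derive.
have nP : \forall s \near tm 13%N, g s = P s.
  near=> s; rewrite P_right //; apply: ltW; near: s; exact: lt_nbhsr.
have nQ : \forall s \near tm 18%N, g s = Q s.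
  near=> s; rewrite Q_left //; apply: ltW; near: s; exact: lt_nbhsl.
apply: (@single_transversal_meeting R P Q (tm 12%N - 1) (tm 13%N) (tm 14%N)
          (tm 17%N) (tm 18%N) (tm 19%N + 1) u v) => //.
- by clear -lt12_13 lt13_14; lra.
- by clear -lt17_18 lt18_19; lra.
- rewrite [P (tm 14%N)]P_right; last by clear -lt12_13 lt13_14; lra.
  rewrite /P glue_path_left; last by clear; lra.
  by rewrite /fP [_ - 1 - _]addrAC subrr add0r addNr mul0r addr0; apply: same.
- rewrite [Q (tm 17%N)]Q_left; last by clear -lt17_18 lt18_19; lra.
  rewrite /Q glue_path_right //; last by clear; lra.
  by rewrite /fQ [_ + 1 - _]addrAC subrr add0r mul1r addrC subrK; apply: same.
- rewrite P_right ?Q_left; try by [exact: ltW]; exact: same.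
- move=> s t /P_loop[s' -> hs] /Q_loop[t' -> ht] gst.
  have st : s' != t'.
    apply/eqP => e; rewrite e in hs.
    by clear -hs ht lt3_5 lt5_8 lt8_10 lt10_12 lt12_13 lt13_14 lt14_17 lt17_18;
       case: hs => [[hs _]|hs]; case: ht => [[ht _]|ht]; lra.
  have [||i [j [hi hj si tj]]] := multiple s' t' _ _ st gst.
  + by clear -hs lt3_5 lt5_8 lt8_10 lt10_12 lt12_13 lt13_14 lt14_17 lt17_18 lt18_19;
       case: hs => [[hs _]|hs]; lra.
  + by clear -ht lt3_5 lt5_8 lt8_10 lt10_12 lt12_13 lt13_14 lt14_17 lt17_18 lt18_19;
       case: ht => [[ht _]|ht]; lra.
  have [i13 j18] : i = 13%N /\ j = 18%N.
    apply: exceptional_loops_meet; last by apply/letters => //; rewrite -si -tj.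
      rewrite si in hs; case: hs => [[/andP[h1 h2] _]|/andP[h1 h2]]; apply/orP.
        by right; apply/andP; split; exact: idx_le.
      by left; apply/andP; split; exact: idx_le.
    rewrite tj in ht; case: ht => [[/andP[h1 h2] _]|/andP[h1 h2]]; apply/orP.
      by right; apply/andP; split; exact: idx_le.
    by left; apply/andP; split; exact: idx_le.
  rewrite i13 in si; rewrite j18 in tj.
  clear -hs ht si tj lt3_5 lt5_8 lt8_10 lt10_12 lt12_13 lt13_14 lt14_17 lt17_18.
  split.
    by case: hs => [[_ <-]//|]; rewrite si; lra.
  by case: ht => [[_ <-]//|]; rewrite tj; lra.
- by apply: dloc du1; apply: filterS nP => s /= ->.
- by apply: dloc du2; apply: filterS nP => s /= ->.
- by apply: dloc dv1; apply: filterS nQ => s /= ->.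
- by apply: dloc dv2; apply: filterS nQ => s /= ->.
Unshelve. all: by end_near.
Qed.

End Window.

Lemma nth_rot (T : Type) (x0 : T) k (s : seq T) i : (k <= size s)%N -> (i < size s)%N ->
  nth x0 (rot k s) i = nth x0 s ((i + k) %% size s).
Proof.
move=> ks si; rewrite /rot nth_cat size_drop.
case: ltnP => h.
  by rewrite nth_drop addnC modn_small //; lia.
rewrite nth_take; last by lia.
have -> : (i + k = (i - (size s - k)) + size s)%N by lia.
by rewrite modnDr modn_small //; lia.
Qed.

Section Passes.
Variables (R : realType) (g : R -> R * R).
Hypothesis g1 : forall t, g (t + 1) = g t.

Lemma periodic_nat t n : g (t + n%:R) = g t.
Proof. by elim: n => [|n IHn]; rewrite ?addr0 // -natr1 addrA g1. Qed.

Lemma is_derive_shift (f : R -> R) (a b d : R) : (forall h, f (h + a) = f (h + b)) ->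
  is_derive a 1 f d -> is_derive b 1 f d.
Proof.
move=> fab [df <-].
have e : (fun h : R => h^-1 *: ((f \o shift a) (h *: 1) - f a)) =
         (fun h : R => h^-1 *: ((f \o shift b) (h *: 1) - f b)).
  by apply/funext => h /=; rewrite fab; have := fab 0; rewrite !add0r => ->.
by split; [rewrite /derivable -e | rewrite /derive -e].
Qed.

Variables (ts : seq R).
Hypothesis ts_sorted : sorted <%R ts.
Hypothesis tsP : forall t, t \in ts <-> 0 <= t < 1 /\ crossings g (g t).

Let N := size ts.

(** Continues the list of passing times periodically, so that a window of
    consecutive passages may start anywhere on the circle. *)
Definition pass_time i := nth 0 ts (i %% N) + (i %/ N)%:R.

Hypothesis N0 : (0 < N)%N.

Lemma pass_timeS i : pass_time i < pass_time i.+1.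
Proof.
rewrite /pass_time; have iN : (i %% N < N)%N by rewrite ltn_mod.
have [e|ne] := eqVneq (i %% N).+1 N.
  have -> : (i.+1 %/ N = (i %/ N).+1)%N.
    by rewrite {1}(divn_eq i N) -addnS e -mulSnr mulnK.
  have -> : (i.+1 %% N = 0)%N.
    by rewrite {1}(divn_eq i N) -addnS e -mulSnr modnMl.
  have /tsP[/andP[_ h1] _] : nth 0 ts (i %% N) \in ts by exact: mem_nth.
  have /tsP[/andP[h2 _] _] : nth 0 ts 0 \in ts by exact: mem_nth.
  by rewrite -[(_ %/ _).+1%:R]natr1; lra.
have h : ((i %% N).+1 < N)%N by rewrite ltn_neqAle ne.
have -> : (i.+1 %/ N = i %/ N)%N.
  by rewrite {1}(divn_eq i N) -addnS divnMDl // (divn_small h) addn0.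
have -> : (i.+1 %% N = (i %% N).+1)%N.
  by rewrite {1}(divn_eq i N) -addnS modnMDl (modn_small h).
by rewrite ltrD2r; apply: (sorted_ltn_nth lt_trans).
Qed.

Lemma pass_time_lt i j : (i < j)%N -> pass_time i < pass_time j.
Proof. by move: i j; apply: (@homo_ltn _ pass_time <%R lt_trans pass_timeS). Qed.

Lemma pass_time_ge0 i : 0 <= pass_time i.
Proof.
have /tsP[/andP[h _] _] : nth 0 ts (i %% N) \in ts by rewrite mem_nth ?ltn_mod.
by rewrite addr_ge0.
Qed.

Lemma pass_time_turn i : pass_time (i + N) = pass_time i + 1.
Proof. by rewrite /pass_time modnDr divnDr ?dvdnn // divnn N0 natrD addrA. Qed.

Lemma pass_time_periodic i : g (pass_time i) = g (nth 0 ts (i %% N)).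
Proof. exact: periodic_nat. Qed.

(** Within less than one period, a coincidence of values reduces modulo 1 to a
    double point, so both times belong to the periodic list. *)
Lemma pass_times_complete m k (s t : R) : (k < N)%N ->
  pass_time m <= s <= pass_time (m + k) -> pass_time m <= t <= pass_time (m + k) ->
  s != t -> g s = g t ->
  exists i j, [/\ (m <= i <= m + k)%N, (m <= j <= m + k)%N, s = pass_time i & t = pass_time j].
Proof.
move=> kN hs ht st gst.
have le_idx i j : pass_time i <= pass_time j -> (i <= j)%N.
  by apply: contraTT; rewrite -ltnNge -ltNge => /pass_time_lt.
(* Reduction of the two times to the base period. *)
have reduce (x : R) : 0 <= x -> exists n : nat, 0 <= x - n%:R < 1.
  move=> x0; exists (Num.truncn x); have /andP[h1 h2] := truncn_itv x0.
  by rewrite subr_ge0 h1 /= ltrBlDl natr1.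
have pm0 := pass_time_ge0 m.
have hk : pass_time (m + k) < pass_time m + 1.
  by rewrite -pass_time_turn; apply: pass_time_lt; rewrite ltn_add2l.
have [p hp] := reduce s ltac:(lra).
have [q hq] := reduce t ltac:(lra).
have gp : g (s - p%:R) = g s by rewrite -(periodic_nat _ p) subrK.
have gq : g (t - q%:R) = g t by rewrite -(periodic_nat _ q) subrK.
have spq : s - p%:R != t - q%:R.
  apply: contra st => /eqP e; suff pq : p = q by rewrite -(inj_eq (addIr (- p%:R))) e pq.
  have e' : p%:R - q%:R = s - t :> R by have e2 : s - p%:R = t - q%:R :> R := e; lra.
  have lt1 : - (1 : R) < p%:R - q%:R < (1 : R) by rewrite e'; lra.
  apply/eqP; rewrite eqn_leq -(ltnS p) -(ltnS q) -!(ltr_nat R) -!natr1.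
  by lra.
have cross : crossings g (g s).
  by exists (s - p%:R), (t - q%:R); split; rewrite ?gp ?gq.
have mem (x : R) n : 0 <= x - n%:R < 1 -> g x = g s -> pass_time m <= x <= pass_time (m + k) ->
    exists2 i, (m <= i <= m + k)%N & x = pass_time i.
  move=> hx gx /andP[hx1 hx2]; have gxn : g (x - n%:R) = g x by rewrite -(periodic_nat _ n) subrK.
  have /nthP-/(_ 0)[i iN ei] : x - n%:R \in ts by apply/tsP; rewrite gxn gx.
  have xi : x = pass_time (i + n * N).
    rewrite /pass_time addnC modnMDl (modn_small iN) divnMDl // (divn_small iN) addn0.
    by rewrite ei subrK.
  by exists (i + n * N)%N; rewrite // !le_idx -?xi.
have [i hi si] := mem s p hp erefl hs.
have [j hj tj] := mem t q hq (esym gst) ht.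
by exists i, j.
Qed.

Lemma pass_times_transversal i j : (forall s t : R, 0 <= s < 1 -> 0 <= t < 1 -> s != t ->
    g s = g t -> transversal_at g s t) ->
  g (pass_time i) = g (pass_time j) -> (i %% N != j %% N)%N ->
  transversal_at g (pass_time i) (pass_time j).
Proof.
move=> tr gij ij.
have ti k : 0 <= nth 0 ts (k %% N) < 1.
  by have /tsP[] : nth 0 ts (k %% N) \in ts by rewrite mem_nth ?ltn_mod.
have u : uniq ts by exact: (sorted_uniq lt_trans ltxx).
have nij : nth 0 ts (i %% N) != nth 0 ts (j %% N).
  by rewrite nth_uniq // ltn_mod.
have [|v [w [d1 d2 d3 d4 d0]]] := tr _ _ (ti i) (ti j) nij.
  by rewrite -!pass_time_periodic.
have e k h : g (h + nth 0 ts (k %% N)) = g (h + pass_time k).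
  by rewrite addrA periodic_nat.
exists v, w; split => //.
- by apply: is_derive_shift d1 => h /=; rewrite e.
- by apply: is_derive_shift d2 => h /=; rewrite e.
- by apply: is_derive_shift d3 => h /=; rewrite e.
- by apply: is_derive_shift d4 => h /=; rewrite e.
Qed.

End Passes.

Section ExceptionalNotRealizable.
Variable R : realType.

Lemma exceptional_word_nth i :
  nth ord0 exceptional_word (i %% 18) = inord (exceptional_letter i) :> 'I_9.
Proof.
by rewrite (nth_map 0%N) // /= ltn_mod.
Qed.

Lemma exceptional_letter_lt i : (exceptional_letter i < 9)%N.
Proof.
have /all_nthP : all (fun k => k < 9)%N exceptional_letters by [].
by apply; rewrite ltn_mod.
Qed.

(** Traversing the curve backwards reverses both velocities. *)
Lemma transversal_opp (g : R -> R * R) s t : transversal_at g s t ->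
  transversal_at (g \o -%R) (- s) (- t).
Proof.
have opp (f : R -> R) (a d : R) : is_derive a 1 f d -> is_derive (- a) 1 (f \o -%R) (- d).
  move=> df; have : is_derive (- a) 1 (f \o -%R) (d * -1).
    by apply: is_derive1_comp; rewrite opprK.
  by rewrite mulrN1.
move=> [u [v [d1 d2 d3 d4 d0]]]; exists (- u), (- v); split.
- exact: opp d1.
- exact: opp d2.
- exact: opp d3.
- exact: opp d4.
- by rewrite /= !mulrNN.
Qed.

(** The code of the curve is a relabelled rotation of the exceptional word or of its
    reverse; the reverse is handled by traversing the curve backwards. *)
Theorem exceptional_not_realizable : ~ realizable R exceptional_word.
Proof.
move=> [g [w' [[[cg g1] _ _ tr] [c [ts [c_inj _ ts_sorted tsP ts_w]]] [s [k0 w'E]]]]].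
have sz : size (map s exceptional_word) = 18%N by rewrite !size_map.
(* A rotation by more than the length is the identity. *)
pose k := if (k0 < 18)%N then k0 else 0%N.
have rotk (x : seq 'I_9) : size x = 18%N -> rot k0 x = rot k x.
  by rewrite /k => sx; case: ltnP => // h; rewrite rot0 rot_oversize // sx.
have k18 : (k < 18)%N by rewrite /k; case: ifP.
clearbody k.
have w'_sz : size w' = 18%N by case: w'E => ->; rewrite size_rot ?size_rev.
have ts_sz : size ts = 18%N by rewrite -w'_sz -(size_map c) -ts_w size_map.
have ts0 : (0 < size ts)%N by rewrite ts_sz.
pose T := pass_time ts.
have gT i : g (T i) = c (nth ord0 w' (i %% 18)).
  have h : (i %% 18 < 18)%N by rewrite ltn_mod.
  rewrite (pass_time_periodic g1) ts_sz -(nth_map 0 (g 0)) ?ts_sz // ts_w.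
  by rewrite (nth_map ord0) // w'_sz.
have Tlt := pass_time_lt ts_sorted tsP ts0.
have letters (i j : nat) a b : g (T i) = c (s (inord (exceptional_letter a))) ->
    g (T j) = c (s (inord (exceptional_letter b))) ->
    g (T i) = g (T j) <-> exceptional_letter a = exceptional_letter b.
  move=> -> ->; split=> [/c_inj/perm_inj h|-> //].
  by have := congr1 val h; rewrite /= !inordK ?exceptional_letter_lt.
case: w'E => [|] w'E.
- have word j : g (T (j + (18 - k))%N) = c (s (inord (exceptional_letter j))).
    rewrite gT w'E rotk // nth_rot ?sz ?ltn_mod ?(ltnW k18) // modnDml.
    rewrite -addnA subnK ?(ltnW k18) // modnDr (nth_map ord0) ?size_map ?ltn_mod //.
    by rewrite exceptional_word_nth.
  apply: (@exceptional_window_absurd R g (fun j => T (j + (18 - k))%N)) => //.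
  + by move=> i j _ ij _; apply: Tlt; rewrite ltn_add2r.
  + by move=> i j _ _; apply: letters; exact: word.
  + move=> x y hx hy xy gxy.
    have [|||i [j [hi hj xi yj]]] := @pass_times_complete R g g1 ts ts_sorted tsP ts0
      (3 + (18 - k)) 16 x y _ _ _ xy gxy.
    * by rewrite ts_sz.
    * by rewrite addnAC.
    * by rewrite addnAC.
    exists (i - (18 - k))%N, (j - (18 - k))%N; rewrite !subnK; try lia.
    by split => //; lia.
  + apply: (@pass_times_transversal R g g1 ts ts_sorted tsP ts0 _ _ tr).
      by apply/(letters _ _ 13%N 18%N); rewrite ?word.
    by rewrite ts_sz; lia.
(* The reflection j -> 17 - j of the positions, moved on by whole turns so that it
   stays positive on the window: 53 = 17 + 2 * 18. *)
- have word j : (j <= 19)%N -> g (T (53 - k - j)%N) = c (s (inord (exceptional_letter j))).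
    move=> j19; rewrite gT w'E rotk ?size_rev // nth_rot ?size_rev ?sz ?ltn_mod ?(ltnW k18) //.
    rewrite modnDml nth_rev ?sz ?ltn_mod // (nth_map ord0); last by rewrite size_map /=; clear; lia.
    congr (c (s _)); have -> : (18 - ((53 - k - j + k) %% 18).+1 = j %% 18)%N by clear -j19 k18; lia.
    exact: exceptional_word_nth.
  apply: (@exceptional_window_absurd R (g \o -%R) (fun j => - T (53 - k - j)%N)) => //.
  + by move=> x; apply: continuous_comp; [exact: opp_continuous | exact: cg].
  + by move=> i j h3 ij j19; rewrite ltrN2; apply: Tlt; lia.
  + by move=> i j hi hj; rewrite /= !opprK; apply: letters; apply: word; lia.
  + move=> x y hx hy xy gxy.
    have [||||i [j [hi hj xi yj]]] := @pass_times_complete R g g1 ts ts_sorted tsP ts0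
      (34 - k) 16 (- x) (- y) _ _ _ _ gxy.
    * by rewrite ts_sz.
    * move: hx; have -> : (34 - k + 16 = 53 - k - 3)%N by lia.
      have -> : (34 - k = 53 - k - 19)%N by lia.
      by rewrite lerNl [x <= _]lerNr andbC => ->.
    * move: hy; have -> : (34 - k + 16 = 53 - k - 3)%N by lia.
      have -> : (34 - k = 53 - k - 19)%N by lia.
      by rewrite lerNl [y <= _]lerNr andbC => ->.
    * by rewrite eqr_opp.
    exists (53 - k - i)%N, (53 - k - j)%N.
    have -> : (53 - k - (53 - k - i) = i)%N by lia.
    have -> : (53 - k - (53 - k - j) = j)%N by lia.
    by rewrite -/T in xi yj *; split; [lia | lia | rewrite -xi opprK | rewrite -yj opprK].
  + apply: transversal_opp; apply: (@pass_times_transversal R g g1 ts ts_sorted tsP ts0 _ _ tr).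
      by apply/(letters _ _ 13%N 18%N); rewrite ?word.
    by rewrite ts_sz; lia.
Qed.

End ExceptionalNotRealizable.

(** * Piecewise linear interpolation of integer sequences *)

Section PiecewiseLinear.
Variable R : realType.
Implicit Types (u : int -> int) (x y : R) (z : int).

Definition interp u x : R :=
  (u (Num.floor x))%:~R +
  (x - (Num.floor x)%:~R) * (u (Num.floor x + 1) - u (Num.floor x))%:~R.

Lemma interp_unit u x z : z%:~R <= x <= z%:~R + 1 ->
  interp u x = (u z)%:~R + (x - z%:~R) * (u (z + 1) - u z)%:~R.
Proof.
move=> /andP[zx]; rewrite le_eqVlt => /orP[/eqP xz|xz].
  have -> : x = (z + 1)%:~R by rewrite xz intrD.
  rewrite /interp intrKfloor subrr mul0r addr0 intrD addrAC subrr add0r mul1r.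
  by rewrite intrB subrKC.
by rewrite /interp (@floor_def _ x z) // zx intrD.
Qed.

Lemma interp_int u z : interp u z%:~R = (u z)%:~R.
Proof. by rewrite /interp intrKfloor subrr mul0r addr0. Qed.

(** Where two consecutive steps agree, interpolation is affine across the integer,
    hence differentiable there (interp_derive). *)
Lemma interp_straight u x z d : u z - u (z - 1) = d -> u (z + 1) - u z = d ->
  z%:~R - 1 <= x <= z%:~R + 1 -> interp u x = (u z)%:~R + (x - z%:~R) * d%:~R.
Proof.
move=> d1 d2 /andP[h1 h2]; have [xz|zx] := leP x z%:~R.
  rewrite (@interp_unit u x (z - 1)).
    by rewrite subrK d1 -d1 !intrB; ring.
  by rewrite intrB h1 /= subrK.
by rewrite (@interp_unit u x z) ?d2 // (ltW zx).
Qed.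

Lemma interp_lipschitz u x y : (forall z, `|u (z + 1) - u z| <= 1) ->
  x <= y < x + 1 -> `|interp u y - interp u x| <= y - x.
Proof.
move=> u1 /andP[xy yx1].
have b z : `|(u (z + 1) - u z)%:~R : R| <= 1 by rewrite -intr_norm -[X in _ <= X]/(1%:~R) ler_int u1.
pose z := Num.floor x; have /andP[z1 z2] := floor_itv x.
rewrite -/z intrD in z1 z2.
rewrite [interp u x](@interp_unit u x z); last by rewrite z1 ltW.
have [yz|zy] := leP y (z%:~R + 1).
  rewrite [interp u y](@interp_unit u y z); last by rewrite yz (le_trans z1 xy).
  rewrite opprD addrACA subrr add0r -mulrBl opprB addrA subrK normrM.
  rewrite ger0_norm ?subr_ge0 //; apply: ler_piMr; first by rewrite subr_ge0.
  exact: b.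
rewrite [interp u y](@interp_unit u y (z + 1)); last first.
  by rewrite intrD (ltW zy) /=; clear -z2 yx1; lra.
have -> : (u (z + 1))%:~R + (y - (z + 1)%:~R) * (u (z + 1 + 1) - u (z + 1))%:~R -
    ((u z)%:~R + (x - z%:~R) * (u (z + 1) - u z)%:~R) =
    (y - (z%:~R + 1)) * (u (z + 1 + 1) - u (z + 1))%:~R
    + (z%:~R + 1 - x) * (u (z + 1) - u z)%:~R :> R.
  by rewrite !intrB !intrD; ring.
apply: le_trans (ler_normD _ _) _; rewrite !normrM.
have -> : y - x = (y - (z%:~R + 1)) + (z%:~R + 1 - x) by ring.
have zy' : 0 <= y - (z%:~R + 1) by rewrite subr_ge0 ltW.
have zx' : 0 <= z%:~R + 1 - x by rewrite subr_ge0 ltW.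
by apply: lerD; rewrite (ger0_norm zy', ger0_norm zx'); apply: ler_piMr.
Qed.

Lemma interp_continuous u : (forall z, `|u (z + 1) - u z| <= 1) -> continuous (interp u).
Proof.
move=> u1 x; apply/cvgrPdist_lt => e e0.
near=> y; have xy1 : `|x - y| < Num.min e 1.
  by near: y; apply: (@cvgr_dist_lt _ _ _ _ _ id) => //; rewrite lt_min e0 ltr01.
move: xy1; rewrite lt_min => /andP[xye xy1]; apply: le_lt_trans xye.
have [xy|/ltW yx] := leP x y.
  rewrite distrC (distrC x) [X in _ <= X]ger0_norm ?subr_ge0 //.
  apply: interp_lipschitz => //; rewrite xy /=.
  by move: xy1; rewrite distrC ger0_norm ?subr_ge0 // ltrBlDl.
rewrite [X in _ <= X]ger0_norm ?subr_ge0 //.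
apply: interp_lipschitz => //; rewrite yx /=.
by move: xy1; rewrite ger0_norm ?subr_ge0 // ltrBlDl.
Unshelve. all: by end_near.
Qed.

Lemma interp_derive u z d : u z - u (z - 1) = d -> u (z + 1) - u z = d ->
  is_derive (z%:~R : R) 1 (interp u) d%:~R.
Proof.
move=> d1 d2.
have h : is_derive (z%:~R : R) 1 (fun x : R => (u z)%:~R + (x - z%:~R) * d%:~R) d%:~R.
  rewrite (_ : (fun _ => _) = cst ((u z)%:~R - z%:~R * d%:~R) + d%:~R *: (id : R -> R)); last first.
    by apply/funext => x; rewrite !fctE /= /GRing.scale /=; ring.
  have := is_deriveD (is_derive_cst ((u z)%:~R - z%:~R * d%:~R : R) (z%:~R : R) 1)
    (is_deriveZ (d%:~R : R) (is_derive_id (z%:~R : R) 1)).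
  by rewrite add0r /GRing.scale /= mulr1.
apply: near_eq_is_derive h.
near=> x; rewrite (interp_straight d1 d2) //.
by apply/andP; split; apply: ltW; near: x;
  [apply: lt_nbhsr | apply: lt_nbhsl]; rewrite ?ltrBlDr ltrDl ltr01.
Unshelve. all: by end_near.
Qed.

End PiecewiseLinear.

(** * Closed curves on the integer lattice *)

Notation lpoint := (int * int)%type.

Definition det2 (d e : lpoint) : int := d.1 * e.2 - d.2 * e.1.

Definition unit_vector (d : lpoint) : bool := `|d.1| + `|d.2| == 1.

(** A lattice path is a list of points, some of which are labelled by a direction:
    consecutive points are neighbours, and the path goes straight, in the
    direction of the label, through each labelled point. *)
Definition lattice_step (a b : lpoint * option lpoint) : bool :=
  let d := b.1 - a.1 in
  [&& unit_vector d, oapp (eq_op d) true a.2 & oapp (eq_op d) true b.2].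

(** The path returns to a point only at labelled points, with independent
    directions. *)
Definition crossings_only (q : seq (lpoint * option lpoint)) : Prop :=
  forall k l, (k < size q)%N -> (l < size q)%N -> k != l ->
    let a := nth (0, None) q k in let b := nth (0, None) q l in
    a.1 = b.1 -> exists d e, [/\ a.2 = Some d, b.2 = Some e & det2 d e != 0].

Lemma cycle_nth (T : Type) (e : rel T) x0 (s : seq T) i : path.cycle e s -> (i < size s)%N ->
  e (nth x0 s i) (nth x0 s (i.+1 %% size s)%N).
Proof.
case: s => // x s /= /(pathP x0) h si; have := h i; rewrite size_rcons => /(_ si).
rewrite -rcons_cons nth_rcons /= si nth_rcons.
have [h1|h1] := ltnP i (size s); first by rewrite modn_small.
have -> : i = size s by apply/eqP; rewrite eqn_leq h1 -ltnS si.
by rewrite eqxx modnn.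
Qed.

Lemma unit_vectorP d : unit_vector d -> [\/ d = (1, 0), d = (- 1, 0), d = (0, 1) | d = (0, - 1)].
Proof.
case: d => a b; rewrite /unit_vector /= => h.
have : a = 1 /\ b = 0 \/ a = -1 /\ b = 0 \/ a = 0 /\ b = 1 \/ a = 0 /\ b = -1 by lia.
by move=> [[->->]|[[->->]|[[->->]|[->->]]]];
  [apply: Or41|apply: Or42|apply: Or43|apply: Or44].
Qed.

Lemma unit_vector_le1 d : unit_vector d -> `|d.1| <= 1 /\ `|d.2| <= 1.
Proof. by rewrite /unit_vector; lia. Qed.

Lemma unit_vector_horizontal d : unit_vector d -> d.1 != 0 -> d.2 = 0.
Proof. by rewrite /unit_vector; lia. Qed.

Lemma unit_vector_vertical d : unit_vector d -> d.2 != 0 -> d.1 = 0.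
Proof. by rewrite /unit_vector; lia. Qed.

(** Two points on unit edges with the same coordinate: either the edges start at
    the same coordinate, or they run in opposite directions along it. *)
Lemma interp_coord (R : realType) (p p' a a' : int) (s t : R) : 0 <= s < 1 -> 0 <= t < 1 ->
  `|a| <= 1 -> `|a'| <= 1 -> p%:~R + s * a%:~R = p'%:~R + t * a'%:~R ->
  (p = p' /\ s * a%:~R = t * a'%:~R) \/ [/\ p' = p + a, a' = - a & a != 0].
Proof.
move=> /andP[s0 s1] /andP[t0 t1] ha ha' e.
have e' : (p' - p)%:~R = s * a%:~R - t * a'%:~R :> R by rewrite intrB; lra.
have h : a = -1 \/ a = 0 \/ a = 1 by clear -ha; lia.
have h' : a' = -1 \/ a' = 0 \/ a' = 1 by clear -ha'; lia.
have b : -2 < ((p' - p)%:~R : R) < 2.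
  rewrite e'; clear -h h' s0 s1 t0 t1.
  by case: h => [|[|]] ->; case: h' => [|[|]] ->; rewrite ?mulrN1z ?mulr1z ?mulr0z; lra.
move: b; rewrite -[2]/(2%:~R) -mulrNz !ltr_int => b.
have : p' = p \/ p' = p + 1 \/ p' = p - 1 by clear -b; lia.
move=> [|[|]] pp; rewrite {p' b e}pp in e' *.
- by left; split => //; apply/eqP; rewrite -subr_eq0 -e' subrr.
- rewrite addrC addKr in e'; clear -h h' s0 s1 t0 t1 e'.
  case: h => [|[|]] h; case: h' => [|[|]] h'; rewrite h h' ?mulrN1z ?mulr1z ?mulr0z in e' *;
  try (by exfalso; lra); by right.
- rewrite addrC addKr in e'; clear -h h' s0 s1 t0 t1 e'.
  case: h => [|[|]] h; case: h' => [|[|]] h'; rewrite h h' ?mulrN1z ?mulr1z ?mulr0z in e' *;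
  try (by exfalso; lra); by right.
Qed.

Lemma parallel_units (R : realType) (d e : lpoint) (s t : R) :
  unit_vector d -> unit_vector e -> 0 <= s -> 0 <= t ->
  s * d.1%:~R = t * e.1%:~R -> s * d.2%:~R = t * e.2%:~R -> s = t.
Proof.
move=> /unit_vectorP ud /unit_vectorP ue s0 t0.
by case: ud => ->; case: ue => -> /=; rewrite ?mulrN1z ?mulr1z ?mulr0z => c1 c2; lra.
Qed.

Lemma count_gt1 (T : Type) (x0 : T) (a : pred T) (s : seq T) : (1 < count a s)%N ->
  exists i j, [/\ (i < size s)%N, (j < size s)%N, i != j, a (nth x0 s i) & a (nth x0 s j)].
Proof.
elim: s => //= x s IHs; case: (boolP (a x)) => ax /=; last first.
  by rewrite add0n => /IHs[i [j [si sj ij ai aj]]]; exists i.+1, j.+1.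
rewrite addSn add0n ltnS -has_count => /(has_nthP x0)[j sj aj].
by exists 0%N, j.+1.
Qed.

Section LatticeCurve.
Variables (R : realType) (q : seq (lpoint * option lpoint)).
Hypotheses (q_size : (2 < size q)%N) (q_cycle : path.cycle lattice_step q)
  (q_cross : crossings_only q).

Let N := size q.
Let N0 : (0 < N)%N. Proof. exact: leq_trans q_size. Qed.
Let Nz0 : (N%:Z != 0). Proof. by rewrite -lt0n. Qed.

Let item (z : int) := nth (0, None) q `|(z %% N)%Z|%N.
Definition vertex z : lpoint := (item z).1.
Definition direction z : lpoint := vertex (z + 1) - vertex z.

Let item_nat k : (k < N)%N -> item k%:Z = nth (0, None) q k.
Proof. by move=> kN; rewrite /item modz_nat absz_nat modn_small. Qed.

Let item_step z : lattice_step (item z) (item (z + 1)).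
Proof.
have r0 : (0 <= (z %% N)%Z)%R by exact: modz_ge0.
have rN : (`|(z %% N)%Z| < N)%N by rewrite -ltz_nat gez0_abs // ltz_pmod.
have := cycle_nth (0, None) q_cycle rN; congr (lattice_step _ (nth _ _ _)).
rewrite -modzDml -[(z %% N)%Z in RHS](gez0_abs r0).
by rewrite (_ : _ + 1 = `|(z %% N)%Z|.+1%:Z) ?modz_nat // -addn1 PoszD.
Qed.

Lemma direction_unit z : unit_vector (direction z).
Proof. by have /and3P[] := item_step z. Qed.

Let label_direction z d : (item z).2 = Some d -> direction z = d /\ direction (z - 1) = d.
Proof.
move=> e; have /and3P[_ h _] := item_step z; have /and3P[_ _ h'] := item_step (z - 1).
move: h h'; rewrite subrK e /= => /eqP h /eqP h'.
by rewrite /direction /vertex subrK.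
Qed.

Lemma vertex_inj z z' : vertex z = vertex z' -> (z %% N)%Z != (z' %% N)%Z ->
  [/\ det2 (direction z) (direction z') != 0, direction (z - 1) = direction z &
      direction (z' - 1) = direction z'].
Proof.
move=> e ne.
have r (y : int) : (`|(y %% N)%Z| < N)%N.
  by rewrite -ltz_nat gez0_abs ?modz_ge0 // ltz_pmod.
have nr : `|(z %% N)%Z|%N != `|(z' %% N)%Z|%N.
  by apply: contra ne => /eqP h; rewrite -(gez0_abs (modz_ge0 z Nz0)) h gez0_abs ?modz_ge0.
have [d [d' [h h' dd']]] := q_cross (r z) (r z') nr e.
by have [-> ->] := label_direction h; have [-> ->] := label_direction h'.
Qed.

Lemma same_edge z z' : vertex z = vertex z' -> direction z = direction z' ->
  (z %% N)%Z = (z' %% N)%Z.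
Proof.
move=> e d; apply/eqP/negPn/negP => /(vertex_inj e)[+ _ _].
by rewrite d /det2 mulrC subrr.
Qed.

(** Running back along an edge would force the path to turn round at its end, which
    neither a single visit nor a straight double visit allows. *)
Lemma opposite_edge z z' : vertex z' = vertex z + direction z ->
  direction z' = - direction z -> False.
Proof.
move=> e d.
have e1 : vertex (z + 1) = vertex z' by rewrite e /direction subrKC.
have [h|ne] := eqVneq ((z + 1) %% N)%Z (z' %% N)%Z; last first.
  have [+ + _] := vertex_inj e1 ne; rewrite d addrK => + h; rewrite -h.
  by rewrite /det2 /=; apply/negP; rewrite negbK; apply/eqP; ring.
have same y y' : (y %% N)%Z = (y' %% N)%Z -> (vertex y = vertex y') * (direction y = direction y').
  move=> hy; have hv x x' : (x %% N)%Z = (x' %% N)%Z -> vertex x = vertex x'.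
    by move=> hx; rewrite /vertex /item hx.
  by rewrite /direction !(hv _ _ hy) (hv (y + 1) (y' + 1)) // -modzDml hy modzDml.
have d1 : direction (z + 1) = - direction z by rewrite (same _ _ h).2.
have e2 : vertex (z + 1 + 1) = vertex z.
  by rewrite -[LHS](subrK (vertex (z + 1))) -/(direction (z + 1)) d1 /direction opprB subrK.
have ne : ((z + 1 + 1) %% N)%Z != (z %% N)%Z.
  rewrite eqz_mod_dvd (_ : z + 1 + 1 - z = 2); last by ring.
  by rewrite dvdzE /= gtnNdvd.
have [+ + _] := vertex_inj e2 ne; rewrite addrK d1 => + h2; rewrite -h2.
by rewrite /det2 /=; apply/negP; rewrite negbK; apply/eqP; ring.
Qed.

Definition embed (z : lpoint) : R * R := (z.1%:~R, z.2%:~R).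

Lemma embed_inj : injective embed.
Proof. by move=> [a b] [c d] [/intr_inj -> /intr_inj ->]. Qed.

Definition lattice_curve (t : R) : R * R :=
  (interp (fun z => (vertex z).1) (N%:R * t), interp (fun z => (vertex z).2) (N%:R * t)).

Let NR0 : (0 : R) < N%:R. Proof. by rewrite ltr0n. Qed.

Let step1 z : `|(vertex (z + 1)).1 - (vertex z).1| <= 1.
Proof. by have := direction_unit z; rewrite /unit_vector /direction /=; lia. Qed.

Let step2 z : `|(vertex (z + 1)).2 - (vertex z).2| <= 1.
Proof. by have := direction_unit z; rewrite /unit_vector /direction /=; lia. Qed.

Lemma lattice_curve_closed : closed_plane_curve lattice_curve.
Proof.
split.
  have cN : continuous (fun t : R => N%:R * t).
    by move=> t; apply: cvgM; [exact: cvg_cst | exact: cvg_id].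
  have ci u : (forall z, `|u (z + 1) - u z| <= 1) ->
      continuous (fun t : R => interp u (N%:R * t)).
    by move=> u1 t; apply: continuous_comp; [exact: cN | exact: interp_continuous].
  by move=> t; exact: (cvg_pair (ci _ step1 t) (ci _ step2 t)).
move=> t; have per (u : int -> int) x : (forall z : int, u (z + N) = u z) ->
    interp u (x + N%:R) = interp u x :> R.
  move=> uN; have fl : Num.floor (x + N%:R) = Num.floor x + N.
    apply: floor_def; have /andP[h1 h2] := floor_itv x.
    by rewrite intrD in h2; rewrite !intrD -pmulrn; lra.
  rewrite /interp fl [_ + N%:Z + 1]addrAC !uN intrD; congr (_ + _ * _).
  by rewrite -pmulrn; ring.
by rewrite /lattice_curve mulrDr mulr1 !per // => z; rewrite /vertex /item modzDr.
Qed.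

Lemma lattice_curve_vertex k : lattice_curve (k%:R / N%:R) = embed (vertex k%:Z).
Proof.
by rewrite /lattice_curve mulrCA divff ?gt_eqF // mulr1 pmulrn !interp_int.
Qed.

Lemma lattice_curve_edge t : 0 <= t < 1 -> exists k th, [/\ (k < N)%N, 0 <= th < 1,
  t = (k%:R + th) / N%:R & lattice_curve t =
    ((vertex k%:Z).1%:~R + th * (direction k%:Z).1%:~R,
     (vertex k%:Z).2%:~R + th * (direction k%:Z).2%:~R)].
Proof.
move=> /andP[t0 t1]; have x0 : 0 <= N%:R * t by rewrite mulr_ge0 // ltW.
have xN : N%:R * t < N%:R by rewrite gtr_pMr.
have /andP[k1 k2] := truncn_itv x0; set k := Num.truncn _ in k1 k2.
exists k, (N%:R * t - k%:R); split.
- by rewrite -(ltr_nat R); apply: le_lt_trans xN.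
- by rewrite subr_ge0 k1 /= ltrBlDl natr1.
- by rewrite subrKC mulrAC divff ?gt_eqF // mul1r.
- have h : ((k%:Z)%:~R : R) <= N%:R * t <= (k%:Z)%:~R + 1.
    by rewrite -pmulrn k1 natr1 ltW.
  by rewrite /lattice_curve !(@interp_unit R _ _ k%:Z h) -pmulrn.
Qed.

(** Two edges can only meet at a common starting point: equal or opposite edges
    are excluded by same_edge and opposite_edge. *)
Lemma lattice_curve_multiple s t : 0 <= s < 1 -> 0 <= t < 1 -> s != t ->
  lattice_curve s = lattice_curve t -> exists k l, [/\ (k < N)%N, (l < N)%N,
    s = k%:R / N%:R, t = l%:R / N%:R & k != l /\ vertex k%:Z = vertex l%:Z].
Proof.
move=> /lattice_curve_edge[k [th [kN hth -> ->]]].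
move=> /lattice_curve_edge[l [ph [lN hph -> ->]]] ne [e1 e2].
have small (m : nat) : (m < N)%N -> (m%:Z %% N)%Z = m%:Z.
  by move=> mN; rewrite modz_nat modn_small.
have [ud ue] := (direction_unit k%:Z, direction_unit l%:Z).
have [d1 d2] := unit_vector_le1 ud; have [d1' d2'] := unit_vector_le1 ue.
have pairE (a b : lpoint) : a.1 = b.1 -> a.2 = b.2 -> a = b.
  by case: a b => [? ?] [? ?] /= -> ->.
have := interp_coord hth hph d1 d1' e1; have := interp_coord hth hph d2 d2' e2.
have := @opposite_edge k%:Z l%:Z; have := @same_edge k%:Z l%:Z; rewrite !small //.
move: ud ue {e1 e2 d1 d2 d1' d2'}; move: (direction k) (direction l) => d d'.
move=> ud ue same opp [[v2 c2]|[v2 c2 c2']] [[v1 c1]|[v1 c1 c1']].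
- have vv : vertex k = vertex l by apply: pairE.
  (* Both points have the same offset along their edges: they are the common vertex,
     or else the edges agree. *)
  have thph : th = ph.
    by case/andP: hth => ? _; case/andP: hph => ? _; apply: (parallel_units ud ue).
  have [th0|th0] := eqVneq th 0.
    exists k, l; rewrite -thph th0 !addr0; split => //; split => //.
    by apply: contra ne => /eqP ->; rewrite thph.
  suff dd : d = d' by case: (same vv dd) => kl; rewrite kl thph eqxx in ne.
  by apply: pairE; apply/eqP; rewrite -(eqr_int R); apply/eqP/(mulfI th0); rewrite ?c1 ?c2 thph.
- have d20 := unit_vector_horizontal ud c1'.
  have d20' : d'.2 = 0 by apply: unit_vector_horizontal => //; rewrite c1 oppr_eq0.
  by exfalso; apply: opp; apply: pairE; rewrite /= ?d20 ?d20' ?addr0 ?oppr0.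
- have d10 := unit_vector_vertical ud c2'.
  have d10' : d'.1 = 0 by apply: unit_vector_vertical => //; rewrite c2 oppr_eq0.
  by exfalso; apply: opp; apply: pairE; rewrite /= ?d10 ?d10' ?addr0 ?oppr0.
- by exfalso; rewrite (unit_vector_horizontal ud c1') in c2'.
Qed.

Variables (n : nat) (w : seq 'I_n) (c : 'I_n -> lpoint).
Hypotheses (w_twice : double_occurrence w) (c_inj : injective c)
  (q_word : [seq z.1 | z <- q & isSome z.2] = [seq c i | i <- w]).

Let vertex_nat k : (k < N)%N -> vertex k%:Z = (nth (0, None) q k).1.
Proof. by move=> kN; rewrite /vertex item_nat. Qed.

Let labelled k := isSome (nth (0, None) q k).2.

Let multiple_labelled k l : (k < N)%N -> (l < N)%N -> k != l -> vertex k%:Z = vertex l%:Z ->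
  labelled k.
Proof.
move=> kN lN kl; rewrite !vertex_nat // => /(q_cross kN lN kl)[d [e [dE _ _]]].
by rewrite /labelled dE.
Qed.

Let labelled_letter k : (k < N)%N -> labelled k -> exists x, vertex k%:Z = c x.
Proof.
move=> kN lk; have : vertex k%:Z \in [seq c i | i <- w].
  by rewrite -q_word vertex_nat //; apply: map_f; rewrite mem_filter mem_nth // andbT.
by case/mapP => x _ ->; exists x.
Qed.

Let unit_interval k : (k < N)%N -> 0 <= (k%:R / N%:R : R) < 1.
Proof.
by move=> kN; rewrite divr_ge0 ?ler0n //= ltr_pdivrMr // mul1r ltr_nat.
Qed.

Let frac_eq k l : (k%:R / N%:R == l%:R / N%:R :> R) = (k == l).
Proof.
have Vinv : (N%:R : R)^-1 != 0 by rewrite invr_eq0 gt_eqF.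
by apply/eqP/eqP => [/(mulIf Vinv)/eqP|-> //]; rewrite eqr_nat => /eqP.
Qed.

(** A double point is labelled because the path crosses itself there; conversely
    every label occurs twice. *)
Lemma lattice_crossings : crossings lattice_curve = range (embed \o c).
Proof.
apply/seteqP; split=> p /=.
  move=> [s [t [hs ht st <- gts]]].
  have [k [l [kN lN -> _ [kl vkl]]]] := lattice_curve_multiple hs ht st (esym gts).
  have [x vk] := labelled_letter kN (multiple_labelled kN lN kl vkl).
  by exists x; rewrite //= lattice_curve_vertex vk.
move=> [x _ <-].
have : (1 < count (fun z : lpoint * option lpoint => (z.1 == c x) && isSome z.2) q)%N.
  have -> : count (fun z : lpoint * option lpoint => (z.1 == c x) && isSome z.2) q
      = count_mem (c x) [seq z.1 | z <- q & isSome z.2].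
    by rewrite count_map count_filter.
  rewrite q_word count_map (@eq_count _ _ (pred1 x)) ?w_twice // => y /=.
  by rewrite (inj_eq c_inj).
move=> /(count_gt1 (0, None))[k [l [kN lN kl /andP[/eqP vk _] /andP[/eqP vl _]]]].
exists (k%:R / N%:R), (l%:R / N%:R); split; rewrite ?unit_interval //.
- by rewrite frac_eq.
- by rewrite lattice_curve_vertex vertex_nat // vk.
- by rewrite lattice_curve_vertex vertex_nat // vl.
Qed.

Lemma lattice_transversal k l : (k < N)%N -> (l < N)%N -> k != l ->
  vertex k%:Z = vertex l%:Z -> transversal_at lattice_curve (k%:R / N%:R) (l%:R / N%:R).
Proof.
move=> kN lN kl v.
have [|dd dk dl] := @vertex_inj k%:Z l%:Z v; first by rewrite !modz_nat !modn_small.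
have der (u : int -> int) (m : nat) (d : int) : u m%:Z - u (m%:Z - 1) = d -> u (m%:Z + 1) - u m%:Z = d ->
    is_derive (m%:R / N%:R : R) 1 (fun t => interp u (N%:R * t)) (d%:~R * N%:R).
  move=> d1 d2; apply: is_derive1_comp.
    by rewrite mulrCA divff ?gt_eqF // mulr1 pmulrn; exact: interp_derive.
  have := is_deriveZ (N%:R : R) (is_derive_id (m%:R / N%:R : R) 1).
  by rewrite /GRing.scale /= mulr1.
have dir (m : nat) : direction (m%:Z - 1) = direction m%:Z ->
   vertex m%:Z - vertex (m%:Z - 1) = direction m%:Z by move=> <-; rewrite /direction subrK.
exists ((direction k%:Z).1%:~R * N%:R, (direction k%:Z).2%:~R * N%:R).
exists ((direction l%:Z).1%:~R * N%:R, (direction l%:Z).2%:~R * N%:R).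
split; rewrite /=.
- by apply: der => //; exact: (congr1 fst (dir _ dk)).
- by apply: der => //; exact: (congr1 snd (dir _ dk)).
- by apply: der => //; exact: (congr1 fst (dir _ dl)).
- by apply: der => //; exact: (congr1 snd (dir _ dl)).
rewrite mulrACA [X in _ - X]mulrACA -mulrBl -!intrM -intrB.
by rewrite mulf_neq0 ?intr_eq0 // mulf_neq0 // gt_eqF.
Qed.

(** At a triple point three unit vectors would be pairwise independent, which is
    impossible among the four lattice directions. *)
Lemma lattice_realizable : realizable R w.
Proof.
exists lattice_curve, w; split; last first.
- exists 1%g, 0%N; left; rewrite rot0 -[LHS]map_id; apply: eq_map => x.
  by rewrite perm1.
- exists (embed \o c), [seq k%:R / N%:R | k <- iota 0 N & labelled k]; split.
  + by move=> x y /embed_inj/c_inj.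
  + by rewrite lattice_crossings.
  + rewrite sorted_map; apply: (@sub_sorted _ ltn).
      by move=> k l /= kl; rewrite ltr_pM2r ?invr_gt0 // ltr_nat.
    by apply: sorted_filter; [exact: ltn_trans | exact: iota_ltn_sorted].
  + move=> t; split.
      move=> /mapP[k]; rewrite mem_filter mem_iota /= add0n => /andP[lk kN] ->.
      rewrite unit_interval // lattice_crossings lattice_curve_vertex.
      by have [x ->] := labelled_letter kN lk; split => //; exists x.
    move=> [ht [s [s' [hs hs' ss' gs gs']]]].
    have [r hr [rt gr]] : exists2 r, 0 <= r < 1 & t != r /\ lattice_curve t = lattice_curve r.
      have [ts|ts] := eqVneq t s; last by exists s.
      by exists s'; rewrite ?gs' //; split => //; rewrite ts.
    have [k [l [kN lN -> _ [kl v]]]] := lattice_curve_multiple ht hr rt gr.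
    apply: map_f; rewrite mem_filter mem_iota /= add0n kN andbT.
    exact: (multiple_labelled kN lN kl v).
  + rewrite (map_comp embed) -q_word -[in RHS](take_size q) -(map_nth_iota0 (0, None) (leqnn N)).
    rewrite filter_map -!map_comp; apply/eq_in_map => k.
    rewrite mem_filter mem_iota /= add0n => /andP[_ kN].
    by rewrite lattice_curve_vertex vertex_nat.
- split.
  + exact: lattice_curve_closed.
  + by rewrite lattice_crossings; apply: finite_image; exact: finite_finset.
  + move=> r s t hr hs ht rs rt.
    have [->|nrs] := eqVneq r s; first exact: Or31.
    have [->|nrt] := eqVneq r t; first exact: Or32.
    have [->|nst] := eqVneq s t; first exact: Or33.
    have vd x y : 0 <= x < 1 -> 0 <= y < 1 -> x != y -> lattice_curve x = lattice_curve y ->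
        exists k l : nat, [/\ x = k%:R / N%:R, y = l%:R / N%:R &
           det2 (direction k%:Z) (direction l%:Z) != 0].
      move=> hx hy xy /(lattice_curve_multiple hx hy xy)[k [l [kN lN ex ey [kl v]]]].
      exists k, l; split => //; have [|//] := @vertex_inj k%:Z l%:Z v.
      by rewrite !modz_nat !modn_small.
    (* Three coinciding vertices would have pairwise independent directions. *)
    have [k [l [rk sl dkl]]] := vd r s hr hs nrs rs.
    have [k' [m [rk' tm dkm]]] := vd r t hr ht nrt rt.
    have [l' [m' [sl' tm' dlm]]] := vd s t hs ht nst (etrans (esym rs) rt).
    have same i j : i%:R / N%:R = j%:R / N%:R :> R -> i = j.
      by move/eqP; rewrite frac_eq => /eqP.
    have kk : k' = k by apply: same; rewrite -rk' -rk.
    have ll : l' = l by apply: same; rewrite -sl' -sl.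
    have mm : m' = m by apply: same; rewrite -tm' -tm.
    rewrite {}kk in dkm; rewrite {}ll {}mm in dlm.
    by move: dkl dkm dlm; case/unit_vectorP: (direction_unit k) => ->;
      case/unit_vectorP: (direction_unit l) => ->; case/unit_vectorP: (direction_unit m) => ->.
  + move=> s t hs ht st /(lattice_curve_multiple hs ht st)[k [l [kN lN -> -> [kl v]]]].
    exact: lattice_transversal.
Qed.

End LatticeCurve.

(** * Arches on the lattice *)

(** The m points that follow z in the direction d. *)
Definition run (z d : lpoint) (m : nat) : seq lpoint :=
  [seq (z.1 + t%:Z * d.1, z.2 + t%:Z * d.2) | t <- iota 1 m].

(** Vertically away from the axis to height h, across, and vertically back; the
    boolean p selects the upper or the lower half plane. *)
Definition strand (p : bool) (x0 x1 : int) (h : nat) : seq lpoint :=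
  let s : int := if p then 1 else -1 in
  run (x0, 0) (0, s) h ++ run (x0, s * h%:Z) (sgz (x1 - x0), 0) `|x1 - x0|%N
  ++ run (x1, s * h%:Z) (0, - s) h.

Lemma mem_run z d m y : y \in run z d m -> exists2 t : nat, (1 <= t <= m)%N &
  y.1 = z.1 + t%:Z * d.1 /\ y.2 = z.2 + t%:Z * d.2.
Proof.
by move=> /mapP[t]; rewrite mem_iota add1n ltnS => ht ->; exists t.
Qed.

Lemma uniq_run z d m : unit_vector d -> uniq (run z d m).
Proof.
move=> /unit_vectorP ud; rewrite map_inj_uniq ?iota_uniq // => t t' [].
by case: ud => -> /=; lia.
Qed.

Lemma last_run z d m : last z (run z d m) = (z.1 + m%:Z * d.1, z.2 + m%:Z * d.2).
Proof.
have z0 : z = (z.1 + 0%N%:Z * d.1, z.2 + 0%N%:Z * d.2).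
  by rewrite !mul0r !addr0 -surjective_pairing.
rewrite {1}z0 /run (last_map (fun t : nat => (z.1 + t%:Z * d.1, z.2 + t%:Z * d.2))).
suff -> : last 0%N (iota 1 m) = m by [].
by case: m => // m; rewrite -nth_last size_iota nth_iota.
Qed.

Definition mark (c d : lpoint) (z : lpoint) := if z == c then Some d else None.

Definition marked_step (c d : lpoint) : rel lpoint :=
  fun z z' => lattice_step (z, mark c d z) (z', mark c d z').

(** A straight run passes the marked point c only in its marked direction d. *)
Lemma marked_step_run c d z e m : unit_vector e ->
  (forall t, (t <= m)%N -> (z.1 + t%:Z * e.1, z.2 + t%:Z * e.2) = c -> e = d) ->
  path (marked_step c d) z (run z e m).
Proof.
move=> ue h; set f := fun t : nat => (z.1 + t%:Z * e.1, z.2 + t%:Z * e.2).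
have z0 : z = f 0%N by rewrite /f !mul0r !addr0 -surjective_pairing.
have step t : (t < m)%N -> marked_step c d (f t) (f t.+1).
  move=> tm; rewrite /marked_step /lattice_step /=.
  have -> : f t.+1 - f t = e.
    have tE : t.+1%:Z = t%:Z + 1 by rewrite -addn1 PoszD.
    rewrite [RHS]surjective_pairing /f tE; congr (_, _); rewrite /=; ring.
  rewrite ue /mark /=; apply/andP; split.
    by case: eqP => //= /(h t (ltnW tm)) ->.
  by case: eqP => //= /(h _ tm) ->.
apply/(pathP z) => i; rewrite size_map size_iota => im.
rewrite (nth_map 0%N) ?size_iota // nth_iota // add1n -/(f _).
case: i im => [|i] im; first by rewrite /= z0; exact: step.
by rewrite /= (nth_map 0%N) ?size_iota 1?ltnW // nth_iota 1?ltnW // add1n; exact: step.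
Qed.

Lemma last_strand p x0 x1 h : x0 != x1 -> last (x0, 0) (strand p x0 x1 h) = (x1, 0).
Proof.
move=> x01; rewrite /strand !last_cat last_run /= mulr0 addr0 add0r.
rewrite (_ : h%:Z * _ = (if p then 1 else -1) * h%:Z); last by rewrite mulrC.
rewrite [X in last X _]last_run /= mulr0 addr0.
have -> : x0 + `|x1 - x0|%N%:Z * sgz (x1 - x0) = x1.
  by rewrite mulrC abszE -[_ * _]/(sgz _ * _) -numEsg subrKC.
by rewrite last_run /=; congr (_, _); [rewrite mulr0 addr0 | case: (p); lia].
Qed.

Lemma mem_strand p x0 x1 h z : (0 < h)%N -> z \in strand p x0 x1 h ->
  let y := if p then z.2 else - z.2 in
  z = (x1, 0) \/ (1 <= y <= h%:Z) /\
     (z.1 = x0 \/ z.1 = x1 \/ (y = h%:Z /\ Num.min x0 x1 <= z.1 <= Num.max x0 x1)).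
Proof.
move=> h0; rewrite /strand; set s : int := if p then 1 else -1.
have sp (u : int) : (if p then s * u else - (s * u)) = u by rewrite /s; case: (p); lia.
rewrite !mem_cat => /or3P[] /mem_run[t ht] /=.
- rewrite mulr0 addr0 add0r mulrC => -[z1 z2]; right; rewrite z1 z2 sp.
  by split; [lia | left].
- rewrite mulr0 addr0 => -[z1 z2]; right; rewrite z1 z2 sp.
  split; first by lia.
  right; right; split => //.
  by case: (sgzP (x1 - x0)) ht => /= h1 ht; lia.
- rewrite mulr0 addr0 mulrN [t%:Z * s]mulrC -mulrBr => -[z1 z2].
  have [th|th] := eqVneq t h.
    by left; rewrite [z]surjective_pairing z1 z2 th subrr mulr0.
  by right; rewrite z1 z2 sp; split; [lia | right; left].
Qed.

Lemma uniq_strand p x0 x1 h : (0 < h)%N -> x0 != x1 -> uniq (strand p x0 x1 h).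
Proof.
move=> h0 x01; rewrite /strand; set s : int := if p then 1 else -1.
have s1 : s = 1 \/ s = -1 by rewrite /s; case: (p); [left|right].
have sh (t t' : nat) : s * t%:Z = s * t'%:Z -> t = t' by case: s1 => ->; lia.
have us : unit_vector (0, s) by case: s1 => ->.
have us' : unit_vector (0, - s) by case: s1 => ->.
have ud : unit_vector (sgz (x1 - x0), 0).
  by rewrite /unit_vector /= normr0 addr0; case: sgzP => //; lia.
rewrite !cat_uniq !uniq_run //= andbT; apply/andP; split.
  apply/hasPn => z; rewrite mem_cat => /orP[] /mem_run[t ht] /= [z1 z2];
    apply/negP => /mem_run[t' ht'] /= [z1' z2'].
    rewrite mulr0 addr0 in z1'; rewrite z1' in z1.
    by case: (sgzP (x1 - x0)) z1 ht => /= ? z1 ht; lia.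
  by rewrite mulr0 addr0 in z1; rewrite mulr0 addr0 z1 in z1'; rewrite z1' eqxx in x01.
apply/hasPn => z /mem_run[t ht] /= [z1 z2]; apply/negP => /mem_run[t' ht'] /= [z1' z2'].
rewrite mulr0 addr0 in z2'; rewrite {}z2' in z2; move: z2 => /eqP.
rewrite -subr_eq0 opprD addrA subrr sub0r oppr_eq0 mulrN oppr_eq0 mulf_eq0.
by case: s1 => ->; lia.
Qed.

(** Each contact point a of the axis is widened to two columns, 3a - 1 for the arch
    with o = false and 3a + 1 for the one with o = true. *)
Definition column (o : bool) (a : nat) : int := (3 * a + 2 * o)%N%:Z - 1.

Definition arch_height (a b : nat) : nat := 3 * (maxn a b - minn a b).

(** The unique crossing of the two arches with ends a and b: the arch with o = true
    is shifted by two columns and raised by one, so its left leg cuts the top of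
    the other one. *)
Definition arch_center (p : bool) (a b : nat) : lpoint :=
  ((3 * minn a b + 1)%N%:Z, (if p then 1 else -1) * (arch_height a b)%:Z).

(** The direction in which an arch from a to b runs through its crossing:
    horizontal along the top when o = false, vertical along the left leg when
    o = true. *)
Definition heading (p o : bool) (a b : nat) : lpoint :=
  let d : int := if (a < b)%N then 1 else -1 in
  if o then (0, (if p then 1 else -1) * d) else (d, 0).

Definition arch_pass (p o : bool) (a b : nat) : seq lpoint :=
  strand p (column o a) (column o b) (arch_height a b + o).

Lemma heading_transversal p a b a' b' :
  det2 (heading p false a b) (heading p true a' b') != 0 /\
  det2 (heading p true a b) (heading p false a' b') != 0.
Proof.
by rewrite /heading; case: p; case: ltnP => _; case: ltnP => _;
  rewrite /det2 /= ?mulN1r ?mul1r.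
Qed.

Lemma arch_centerC p a b : arch_center p a b = arch_center p b a.
Proof. by rewrite /arch_center /arch_height minnC maxnC. Qed.

Section ArchPass.
Variables (p o : bool) (a b : nat).
Hypothesis ab : a != b.

Lemma column_neq : column o a != column o b.
Proof. by move: ab; rewrite /column; lia. Qed.

Lemma arch_height_gt2 : (2 < arch_height a b)%N.
Proof. by move: ab; rewrite /arch_height; lia. Qed.

Lemma arch_pass_path : path (marked_step (arch_center p a b) (heading p o a b))
  (column o a, 0) (arch_pass p o a b).
Proof.
have h0 := arch_height_gt2; have cn := column_neq.
have hE := erefl (arch_height a b); rewrite {2}/arch_height in hE.
rewrite /arch_pass /strand; set s : int := if p then 1 else -1.
set h := (arch_height a b + o)%N.
have s1 : s = 1 \/ s = -1 by rewrite /s; case: (p); [left|right].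
have sh (t t' : int) : s * t = s * t' -> t = t' by case: s1 => ->; lia.
rewrite !cat_path; apply/and3P; split.
- apply: marked_step_run; first by case: s1 => ->.
  move=> t th [e1 e2]; rewrite mulr0 addr0 in e1; rewrite /heading.
  move: ab e1; rewrite /column; case: (o) => /=; case: ltnP => ? ? ? ; try lia.
  by rewrite -/s mulr1.
- rewrite last_run /= mulr0 addr0 add0r [_ * s]mulrC.
  apply: marked_step_run.
    by rewrite /unit_vector /= normr0 addr0; move: cn; case: sgzP => //; lia.
  move=> t th [e1 /=]; rewrite mulr0 addr0 => /sh e2; move: e1 e2.
  rewrite /h /heading; case: (o) => /= e1 e2; first by lia.
  by congr (_, _); move: ab; rewrite /column; case: sgzP; case: ltnP => //; lia.
- rewrite !last_run /= !mulr0 !addr0 add0r [_ * s]mulrC last_run /= mulr0 addr0.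
  have -> : column o a + `|column o b - column o a|%N%:Z * sgz (column o b - column o a) = column o b.
    by rewrite mulrC abszE -[_ * _]/(sgz _ * _) -numEsg subrKC.
  apply: marked_step_run; first by case: s1 => ->.
  move=> t th [e1 e2]; rewrite /= mulr0 addr0 in e1; rewrite /heading.
  move: ab e1; rewrite /column; case: (o) => /=; case: ltnP => ? ? ? ; try lia.
  by rewrite -/s mulrN1.
Qed.

Lemma last_arch_pass : last (column o a, 0) (arch_pass p o a b) = (column o b, 0).
Proof. exact/last_strand/column_neq. Qed.

Lemma uniq_arch_pass : uniq (arch_pass p o a b).
Proof. by apply: uniq_strand column_neq; have := arch_height_gt2; lia. Qed.

Lemma mem_arch_pass z : z \in arch_pass p o a b ->
  let y := if p then z.2 else - z.2 in
  z = (column o b, 0) \/ (1 <= y <= (arch_height a b + o)%N%:Z) /\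
     (z.1 = column o a \/ z.1 = column o b \/
      (y = (arch_height a b + o)%N%:Z /\
       column o (minn a b) <= z.1 <= column o (maxn a b))).
Proof.
have h0 := arch_height_gt2; move=> /mem_strand-/(_ ltac:(lia)) /=.
have -> : Num.min (column o a) (column o b) = column o (minn a b) by rewrite /column; lia.
by have -> : Num.max (column o a) (column o b) = column o (maxn a b) by rewrite /column; lia.
Qed.

Lemma arch_center_mem : arch_center p a b \in arch_pass p o a b.
Proof.
have h0 := arch_height_gt2; have hE := erefl (arch_height a b); rewrite {2}/arch_height in hE.
rewrite /arch_pass /strand !mem_cat /arch_center; set s : int := if p then 1 else -1.
have [_|_] := boolP o.
  have [lt_ab|le_ba] := ltnP a b.
    apply/orP; left; apply/mapP; exists (arch_height a b); first by rewrite mem_iota; lia.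
    by rewrite /= mulr0 addr0 add0r mulrC; congr (_, _); rewrite /column; lia.
  apply/orP; right; apply/orP; right; apply/mapP; exists 1%N; first by rewrite mem_iota; lia.
  have -> : (arch_height a b + true)%N%:Z = (arch_height a b)%:Z + 1 by rewrite addn1 -addn1 PoszD.
  rewrite /= mulr0 addr0 mul1r mulrDr mulr1 addrK; congr (_, _).
  by rewrite /column; move: ab le_ba; lia.
apply/orP; right; apply/orP; left; apply/mapP.
have [lt_ab|le_ba] := ltnP a b.
  exists 2%N; first by rewrite mem_iota /column; lia.
  rewrite /= addn0 mulr0 addr0; congr (_, _); rewrite /column.
  by case: sgzP; lia.
have lt_ba : (b < a)%N by rewrite ltn_neqAle eq_sym ab.
exists (arch_height a b - 2)%N; first by rewrite mem_iota /column; lia.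
rewrite /= addn0 mulr0 addr0; congr (_, _); rewrite /column.
by case: sgzP; lia.
Qed.

End ArchPass.

(** The points of an arch off the axis. *)
Definition arch_region (p o : bool) (a b : nat) (z : lpoint) : Prop :=
  let y := if p then z.2 else - z.2 in
  1 <= y <= (arch_height a b + o)%N%:Z /\
  (z.1 = column o a \/ z.1 = column o b \/
   (y = (arch_height a b + o)%N%:Z /\
    column o (minn a b) <= z.1 <= column o (maxn a b))).

(** The arches over the two pairs of ends are disjoint or nested. *)
Definition apart (a b a' b' : nat) : bool :=
  [|| (maxn a b < minn a' b')%N, (maxn a' b' < minn a b)%N,
      (minn a b < minn a' b')%N && (maxn a' b' < maxn a b)%N |
      (minn a' b' < minn a b)%N && (maxn a b < maxn a' b')%N].

Lemma arch_regionC p o a b z : arch_region p o a b z -> arch_region p o b a z.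
Proof.
rewrite /arch_region /arch_height minnC maxnC => -[h1 h2]; split => //.
by case: h2 => [|[|]] h; [right; left|left|right; right].
Qed.

Lemma regions_apart p o a b o' a' b' z : apart a b a' b' ->
  arch_region p o a b z -> arch_region p o' a' b' z -> False.
Proof.
move: z => [x y]; rewrite /apart /arch_region /arch_height /column /=.
move: (if p then y else - y) => {}y h [h1 h2] [h3 h4].
have := conj (leq_b1 o) (leq_b1 o').
by move: (nat_of_bool o) (nat_of_bool o') h1 h2 h3 h4 => i j; lia.
Qed.

Lemma regions_opposite p o a b o' a' b' z :
  arch_region p o a b z -> arch_region (~~ p) o' a' b' z -> False.
Proof. by move=> [h1 _] [h2 _]; case: p h1 h2 => /=; lia. Qed.

Lemma regions_crossing p a b z : a != b ->
  arch_region p false a b z -> arch_region p true a b z -> z = arch_center p a b.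
Proof.
move: z => [x y] ab; rewrite /arch_region /= => -[h1 h2] [h3 h4].
suff [hx hy] : x = (3 * minn a b + 1)%N%:Z /\ (if p then y else - y) = (arch_height a b)%:Z.
  by rewrite /arch_center hx -hy; case: (p) => /=; rewrite ?mul1r ?mulN1r ?opprK.
move: (if p then y else - y) h1 h2 h3 h4 => {}y; rewrite /column /arch_height; lia.
Qed.

(** * Curves drawn from two-page arch diagrams *)

Arguments strand : simpl never.
Arguments run : simpl never.

Definition unit_step : rel lpoint := fun z z' => unit_vector (z' - z).

Lemma unit_step_run z d m : unit_vector d -> path unit_step z (run z d m).
Proof.
move=> ud; apply: sub_path (@marked_step_run z d z d m ud _) => // x y.
by case/and3P.
Qed.

Lemma unit_step_strand p x0 x1 h : x0 != x1 -> path unit_step (x0, 0) (strand p x0 x1 h).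
Proof.
move=> x01; rewrite /strand; set s : int := if p then 1 else -1.
have s1 : s = 1 \/ s = -1 by rewrite /s; case: (p); [left|right].
rewrite !cat_path !last_run /= !mulr0 !addr0 add0r [_ * s]mulrC last_run /= mulr0 addr0.
apply/and3P; split; try apply: unit_step_run.
- by case: s1 => ->.
- by rewrite /unit_vector /= normr0 addr0; move: x01; case: sgzP => //; lia.
have -> : x0 + `|x1 - x0|%N%:Z * sgz (x1 - x0) = x1.
  by rewrite mulrC abszE -[_ * _]/(sgz _ * _) -numEsg subrKC.
by apply: unit_step_run; case: s1 => ->.
Qed.

Definition unmarked (z : lpoint) : lpoint * option lpoint := (z, None).

Lemma unmarked_path z s : path unit_step z s -> path lattice_step (unmarked z) (map unmarked s).
Proof.
by rewrite path_map; apply: sub_path => x y; rewrite /unit_step /lattice_step /= => ->.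
Qed.

Lemma flatten_path (T : eqType) (e : rel T) (P : nat -> T) (f : nat -> seq T) m k :
  (forall i, (k <= i < k + m)%N -> path e (P i) (f i) /\ last (P i) (f i) = P i.+1) ->
  path e (P k) (flatten [seq f i | i <- iota k m]) /\
  last (P k) (flatten [seq f i | i <- iota k m]) = P (k + m)%N.
Proof.
elim: m k => [|m IHm] k h /=; first by rewrite addn0.
have [h1 h2] := h k ltac:(lia).
have [|h3 h4] := IHm k.+1; first by move=> i hi; apply: h; lia.
by rewrite cat_path last_cat h1 h2 h3 h4 addSnnS.
Qed.

Lemma flatten_pairwise (T : eqType) (r : rel T) (f : nat -> seq T) m k :
  (forall i, (k <= i < k + m)%N -> pairwise r (f i)) ->
  (forall i j u v, (k <= i)%N -> (i < j)%N -> (j < k + m)%N -> u \in f i -> v \in f j -> r u v) ->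
  pairwise r (flatten [seq f i | i <- iota k m]).
Proof.
elim: m k => [|m IHm] k h1 h2 //=.
rewrite pairwise_cat h1 /=; last by lia.
rewrite IHm => [|i hi|i j u v hi ij hj]; last 2 first.
- by apply: h1; lia.
- by apply: h2; lia.
rewrite andbT; apply/allrelP => u v uf /flatten_mapP[j]; rewrite mem_iota => hj vf.
by apply: (h2 k j) => //; lia.
Qed.

Definition compatible : rel (lpoint * option lpoint) := fun u v =>
  (u.1 == v.1) ==>
  (if u.2 is Some d then if v.2 is Some e then det2 d e != 0 else false else false).

Lemma compatible_crossings q : pairwise compatible q -> crossings_only q.
Proof.
move=> /(pairwiseP (0, None)) h k l kN lN kl /= e.
wlog ltkl : k l kN lN kl e / (k < l)%N => [hw|].
  have [|lk|kl'] := ltngtP k l; [exact: hw | | by rewrite kl' eqxx in kl].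
  have [|d [d' [h1 h2 h3]]] := hw l k lN kN _ (esym e) lk; first by rewrite eq_sym.
  exists d', d; split => //; apply: contra h3 => /eqP; rewrite /det2 => h4.
  by apply/eqP; rewrite -[RHS]oppr0 -h4; ring.
have := h k l kN lN ltkl; rewrite /compatible e eqxx /=.
case: (nth _ q k) => _ [] //= d; case: (nth _ q l) => _ [] //= d' dd.
by exists d, d'.
Qed.

Section ArchDiagram.
Variables (n N : nat) (letter : nat -> 'I_n) (J : nat -> nat).
Variables (A B : 'I_n -> nat) (pg : 'I_n -> bool).

(** On the unfolded curve the i-th gap, between the passages i and i + 1, occupies
    the segment of the axis between the contact points J i and J i + 1; it is
    traversed forwards when i is odd and backwards when i is even.  Hence the
    passage i leads from the contact point arrival i to departure i. *)
Definition arrival i := if odd i then J i.-1 else if i is i'.+1 then (J i').+1 else 0%N.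
Definition departure i := if odd i then J i else (J i).+1.

Hypotheses (N_gt0 : (0 < N)%N) (N_even : ~~ odd N).
Hypotheses (J_lt : forall i, (i < N)%N -> (J i < N)%N)
  (J_inj : forall i j, (i < N)%N -> (j < N)%N -> J i = J j -> i = j)
  (J_last : J N.-1 = N.-1).
Hypothesis ends : forall i, (i < N)%N ->
  (arrival i, departure i) = (A (letter i), B (letter i)) \/
  (arrival i, departure i) = (B (letter i), A (letter i)).
Hypothesis letter_parity : forall i j, (i < N)%N -> (j < N)%N -> i != j ->
  letter i = letter j -> odd i = ~~ odd j.
Hypothesis noncrossing : forall x y, x != y -> pg x = pg y -> apart (A x) (B x) (A y) (B y).
Hypothesis letter_twice : double_occurrence [seq letter i | i <- iota 0 N].

Let oddN1 : odd N.-1. Proof. by move: N_gt0 N_even; case: (N) => //= m _; rewrite negbK. Qed.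

Let J_succ i : (i < N.-1)%N -> ((J i).+1 < N)%N.
Proof.
move=> iN; have iN' : (i < N)%N by lia.
have ne : J i <> N.-1.
  by move=> h; have := J_inj iN' (j := N.-1) ltac:(lia); rewrite h J_last; lia.
by have := J_lt iN'; lia.
Qed.

Let arrival_lt i : (i < N)%N -> (arrival i < N)%N.
Proof.
rewrite /arrival; case: i => [|i] iN /=; first exact: N_gt0.
by case: ifP => _; [apply: J_lt; lia | apply: J_succ; lia].
Qed.

Let departure_lt i : (i < N)%N -> (departure i < N)%N.
Proof.
move=> iN; rewrite /departure; case: ifP => io; first exact: J_lt.
by apply: J_succ; have : i <> N.-1 by [move=> h; rewrite h oddN1 in io]; lia.
Qed.

Let arrival_neq i : (i < N)%N -> arrival i != departure i.
Proof.
rewrite /arrival /departure; case: i => [|i] iN //=.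
have ne : J i <> J i.+1 by move=> /J_inj; lia.
by case: ifP => _; apply/eqP; lia.
Qed.

Let center x := arch_center (pg x) (A x) (B x).

Let center_pass i : (i < N)%N ->
  arch_center (pg (letter i)) (arrival i) (departure i) = center (letter i).
Proof. by move=> /ends[] [-> ->]; rewrite // arch_centerC. Qed.

Let pass i := arch_pass (pg (letter i)) (odd i) (arrival i) (departure i).

Let outer_height := (3 * N + 3)%N.

(** The last gap closes the curve: it has to return from the right end of the axis
    to the left end, above all arches. *)
Definition outer_gap : seq lpoint :=
  run (column true N.-1, 0) (1, 0) 1 ++
  strand true (3 * N%:Z - 1) (- 2) outer_height ++ run (- 2, 0) (1, 0) 1.

Definition gap i : seq lpoint :=
  if i == N.-1 then outer_gap
  else run (column (odd i) (departure i), 0) (if odd i then 1 else - 1, 0) 1.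

(** The i-th passage, an arch that is marked at its crossing, followed by the
    i-th gap. *)
Definition piece i : seq (lpoint * option lpoint) :=
  [seq (z, mark (center (letter i))
              (heading (pg (letter i)) (odd i) (arrival i) (departure i)) z) | z <- pass i]
  ++ map unmarked (gap i).

Let start i : lpoint := if i == N then (- 1, 0) else (column (odd i) (arrival i), 0).

Let center_y x : A x != B x -> (center x).2 != 0.
Proof.
move=> AB; have := arch_height_gt2 AB; rewrite /center /arch_center /=.
by case: (pg x); lia.
Qed.

Let letter_AB i : (i < N)%N -> A (letter i) != B (letter i).
Proof.
by move=> iN; have := arrival_neq iN; case: (ends iN) => -[-> ->]; rewrite // eq_sym.
Qed.

Let unmarked_row i d (x : int) : (i < N)%N -> mark (center (letter i)) d (x, 0) = None.
Proof.
move=> iN; rewrite /mark; case: eqP => // e.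
by have := center_y (letter_AB iN); rewrite -e eqxx.
Qed.

Let gap_path i : (i < N)%N ->
  path unit_step (column (odd i) (departure i), 0) (gap i) /\
  last (column (odd i) (departure i), 0) (gap i) = start i.+1.
Proof.
move=> iN; rewrite /gap /start; have [iE|iE] := eqVneq i N.-1.
  have -> : i.+1 == N by apply/eqP; lia.
  rewrite iE oddN1 /departure oddN1 J_last /outer_gap.
  have l1 : last (column true N.-1, 0) (run (column true N.-1, 0) (1, 0) 1) =
      (3 * N%:Z - 1, 0).
    by rewrite last_run /= mulr0 addr0 mulr1 /column /=; congr (_, _); lia.
  have l2 : last (3 * N%:Z - 1, 0) (strand true (3 * N%:Z - 1) (- 2) outer_height) = (- 2, 0).
    by apply: last_strand; lia.
  rewrite cat_path l1 cat_path l2 last_cat l1 last_cat l2.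
  split; last by rewrite last_run /= mulr0 addr0.
  apply/and3P; split; try exact: unit_step_run.
  by apply: unit_step_strand; lia.
have -> : (i.+1 == N) = false by apply/eqP; lia.
split; first by apply: unit_step_run; case: ifP.
rewrite last_run /= mulr0 addr0; congr (_, _).
by rewrite /departure /arrival /column /=; case: (odd i) => /=; lia.
Qed.

Let piece_path i : (i < N)%N ->
  path lattice_step (unmarked (start i)) (piece i) /\
  last (unmarked (start i)) (piece i) = unmarked (start i.+1).
Proof.
move=> iN; have [h1 h2] := gap_path iN; have ne := arrival_neq iN.
pose d := heading (pg (letter i)) (odd i) (arrival i) (departure i).
have sE : start i = (column (odd i) (arrival i), 0) by rewrite /start ltn_eqF.
pose m z := (z, mark (center (letter i)) d z).
have mE x : unmarked (x, 0) = m (x, 0) by rewrite /m unmarked_row.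
have lE : last (unmarked (start i)) [seq m z | z <- pass i] =
    unmarked (column (odd i) (departure i), 0).
  by rewrite sE mE (last_map m) last_arch_pass // -mE.
rewrite /piece cat_path last_cat lE; split.
  rewrite unmarked_path // andbT sE mE path_map.
  by have := arch_pass_path (pg (letter i)) (odd i) ne; rewrite center_pass.
by rewrite (last_map unmarked) h2.
Qed.

Definition arch_curve := flatten [seq piece i | i <- iota 0 N].

Lemma arch_curve_cycle : path.cycle lattice_step arch_curve.
Proof.
have [|h1 h2] := @flatten_path _ lattice_step (fun i => unmarked (start i)) piece N 0.
  by move=> i /andP[_ iN]; exact: piece_path.
rewrite (cycle_path (unmarked (start 0%N))).
suff -> : last (unmarked (start 0%N)) arch_curve = unmarked (start 0%N) by [].
rewrite [LHS]h2 /start add0n eqxx; congr unmarked.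
by rewrite ifF //; apply/eqP; lia.
Qed.

Lemma arch_curve_size : (2 < size arch_curve)%N.
Proof.
have h i : (i < N)%N -> (2 < size (piece i))%N.
  move=> iN; rewrite size_cat size_map.
  have ne := arrival_neq iN; have := arch_height_gt2 ne.
  by rewrite /pass /arch_pass /strand !size_cat /run !size_map !size_iota; lia.
have -> : arch_curve = piece 0 ++ flatten [seq piece i | i <- iota 1 N.-1].
  by rewrite /arch_curve -[in iota 0 N](prednK N_gt0).
by rewrite size_cat; apply: leq_trans (h 0%N N_gt0) _; exact: leq_addr.
Qed.

Lemma arch_curve_word :
  [seq z.1 | z <- arch_curve & isSome z.2] = [seq center x | x <- [seq letter i | i <- iota 0 N]].
Proof.
rewrite /arch_curve filter_flatten map_flatten -!map_comp -(flatten_map1 (center \o letter)).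
congr flatten; apply/eq_in_map => i; rewrite mem_iota add0n => /andP[_ iN] /=.
have ne := arrival_neq iN.
rewrite filter_cat map_cat filter_map -map_comp.
rewrite (eq_filter (a2 := pred1 (center (letter i)))); last first.
  by move=> z; rewrite /= /mark; case: eqP.
rewrite filter_pred1_uniq ?uniq_arch_pass //; last first.
  by rewrite -(center_pass iN) arch_center_mem.
by rewrite filter_map (eq_filter (a2 := pred0)) ?filter_pred0.
Qed.

(* The part of the plane allotted to the i-th gap: two points on the axis, or
   else the outside of the box that contains all the arches. *)
Let frame i (z : lpoint) : Prop :=
  (i != N.-1 /\ z.2 = 0 /\ (z.1 = (3 * J i + 1)%N \/ z.1 = (3 * J i + 2)%N)) \/
  (i = N.-1 /\ [\/ z.2 = 0 /\ (z.1 <= -1 \/ 3 * N%:Z - 2 <= z.1),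
                   0 < z.2 /\ (z.1 <= -2 \/ 3 * N%:Z - 1 <= z.1) | z.2 = outer_height]).

Let column_frame i (x : int) : (i < N)%N -> x = column (odd i) (departure i) \/
  (i != N.-1 /\ x = column (odd i) (departure i) + (if odd i then 1 else -1)) -> frame i (x, 0).
Proof.
move=> iN hx; rewrite /frame /=; have [iE|iE] := eqVneq i N.-1.
  right; split => //; apply: Or31; split => //; right.
  by case: hx => [->|[]]; rewrite iE ?eqxx // /departure oddN1 J_last /column /=; lia.
left; split => //; split => //.
by move: hx; rewrite /departure /column; case: (odd i) => /= hx; clear -hx; lia.
Qed.

Let gap_frame i z : (i < N)%N -> z \in gap i -> frame i z.
Proof.
move=> iN; rewrite /gap; case: eqVneq => [iE|iE]; last first.
  move=> /mem_run[t ht] /= [h1 h2]; rewrite [z]surjective_pairing h2 mulr0 addr0.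
  apply: column_frame => //; right; split => //.
  by rewrite h1; have -> : t = 1%N by [lia]; rewrite mul1r.
rewrite 2!mem_cat => h; right; split => //; case/or3P: h.
- move=> /mem_run[t ht] /= [-> ->]; apply: Or31; split; first by lia.
  by right; rewrite /column; lia.
- have h0 : (0 < outer_height)%N by rewrite /outer_height; lia.
  case/(mem_strand h0) => /=; first by move=> ->; apply: Or31; split => //; left.
  move=> [h1 [h|[h|[h _]]]]; last by apply: Or33.
    by apply: Or32; split; [lia | right; rewrite h].
  by apply: Or32; split; [lia | left; rewrite h].
- move=> /mem_run[t ht] /= [-> ->]; apply: Or31; split; first by lia.
  by left; lia.
Qed.

Let region i := arch_region (pg (letter i)) (odd i) (arrival i) (departure i).

Let piece_mem i u : (i < N)%N -> u \in piece i -> frame i u.1 \/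
  region i u.1 /\ u.2 = mark (center (letter i))
     (heading (pg (letter i)) (odd i) (arrival i) (departure i)) u.1.
Proof.
move=> iN; rewrite mem_cat => /orP[] /mapP[z hz ->] /=; last by left; exact: gap_frame.
have [->|hr] := mem_arch_pass (arrival_neq iN) hz; last by right.
by left; apply: column_frame => //; left.
Qed.

Let frame_frame i j z : (i < N)%N -> (j < N)%N -> i != j -> frame i z -> frame j z -> False.
Proof.
move=> iN jN ij; have Jij : J i <> J j by move=> /(J_inj iN jN) h; rewrite h eqxx in ij.
have inner k : (k < N)%N -> k != N.-1 -> (J k < N.-1)%N.
  move=> kN kE; have : J k <> N.-1 by move=> h; have := J_inj kN (j := N.-1) ltac:(lia); lia.
  by have := J_lt kN; lia.
have hH : outer_height = (3 * N + 3)%N by [].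
move=> [[iE [z2 z1]]|[iE hi]] [[jE [z2' z1']]|[jE hj]].
- by move: z1 z1'; lia.
- by have := inner i iN iE; case: hj => [[h h']|[h h']|h]; move: z1 h; lia.
- by have := inner j jN jE; case: hi => [[h h']|[h h']|h]; move: z1' h; lia.
- by rewrite iE jE eqxx in ij.
Qed.

Let region_frame i j z : (i < N)%N -> (j < N)%N -> region i z -> frame j z -> False.
Proof.
move=> iN jN [h1 h2].
have [ai di] := (arrival_lt iN, departure_lt iN).
have hH : outer_height = (3 * N + 3)%N by [].
have o1 := leq_b1 (odd i).
have hx : -1 <= z.1 <= 3 * N%:Z - 2.
  case: h2 => [->|[->|[_]]]; rewrite /column; move: (nat_of_bool (odd i)) o1 => k; clear h1; lia.
have hz0 : z.2 != 0 by move: h1; case: (pg _) => /=; lia.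
have hz1 : z.2 < outer_height.
  by move: h1 o1; rewrite hH /arch_height; move: (nat_of_bool (odd i)) => k; case: (pg _) => /=; lia.
move=> [[_ [h _]]|[_ [[h _]|[_ h]|h]]].
- by rewrite h eqxx in hz0.
- by rewrite h eqxx in hz0.
- by move: hx h; lia.
- by rewrite h ltxx in hz1.
Qed.

Let region_ends i z : (i < N)%N -> region i z ->
  arch_region (pg (letter i)) (odd i) (A (letter i)) (B (letter i)) z.
Proof. by rewrite /region => /ends[] [-> ->] // /arch_regionC. Qed.

Let gap_off_row i z : (i < N)%N -> z \in gap i -> z.1 != column (odd i) (departure i) \/ z.2 != 0.
Proof.
move=> iN; rewrite /gap; case: eqVneq => [iE|iE].
  rewrite iE oddN1 /departure oddN1 J_last 2!mem_cat => /or3P[].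
  - by move=> /mem_run[t ht] /= [-> _]; left; rewrite /column; lia.
  - have h0 : (0 < outer_height)%N by rewrite /outer_height; lia.
    case/(mem_strand h0) => /= [->|[h1 _]]; [left; rewrite /column /=; lia | right; lia].
  - by move=> /mem_run[t ht] /= [-> _]; left; rewrite /column; lia.
by move=> /mem_run[t ht] /= [-> _]; left; case: (odd i); lia.
Qed.

Let gap_uniq i : uniq (gap i).
Proof.
have h0 : (0 < outer_height)%N by rewrite /outer_height; lia.
have ne : (3 * N%:Z - 1 != - 2 :> int) by lia.
rewrite /gap; case: eqVneq => _; last by apply: uniq_run; case: (odd i).
rewrite /outer_gap 2!cat_uniq !uniq_run // (uniq_strand _ h0 ne) !andTb !andbT.
apply/andP; split.
  apply/hasPn => z; rewrite mem_cat => hz; apply/negP => /mem_run[t ht] /= [z1 z2].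
  case/orP: hz; last by move=> /mem_run[t' ht'] /= [z1' _]; move: z1 z1'; rewrite /column; lia.
  move=> /(mem_strand h0)/= [zE|[h _]]; last by rewrite z2 mulr0 in h.
  by move: z1; rewrite zE /column /=; lia.
apply/hasPn => z /mem_run[t ht] /= [z1 z2]; apply/negP => /(mem_strand h0)/= [zE|[h _]].
  by move: z1; rewrite zE /=; lia.
by rewrite z2 mulr0 in h.
Qed.

Let piece_pairwise i : (i < N)%N -> pairwise compatible (piece i).
Proof.
move=> iN; have ne := arrival_neq iN.
have : uniq [seq u.1 | u <- piece i].
  rewrite map_cat -!map_comp !map_id cat_uniq gap_uniq uniq_arch_pass //= andbT.
  apply/hasPn => z hz; apply/negP => /(mem_arch_pass ne)[zE|hr].
    by have := gap_off_row iN hz; rewrite zE !eqxx => -[].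
  exact: (region_frame iN iN hr (gap_frame iN hz)).
rewrite uniq_pairwise pairwise_map; apply: sub_pairwise => u v /=.
by rewrite /compatible => /negPf ->.
Qed.

Let piece_compatible i j u v : (i < N)%N -> (j < N)%N -> i != j ->
  u \in piece i -> v \in piece j -> compatible u v.
Proof.
move=> iN jN ij /(piece_mem iN) hu /(piece_mem jN) hv; apply/implyP => /eqP e.
case: hu hv => [fu|[ru mu]] [fv|[rv mv]].
- by case: (frame_frame iN jN ij fu); rewrite e.
- by case: (region_frame jN iN rv); rewrite -e.
- by case: (region_frame iN jN ru); rewrite e.
have := region_ends iN ru; have := region_ends jN rv; rewrite -e => rj ri.
have [ll|ll] := eqVneq (letter i) (letter j); last first.
  have [pp|pp] := boolP (pg (letter i) == pg (letter j)).
    move/eqP: pp => pp; rewrite -pp in rj.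
    by case: (regions_apart (noncrossing ll pp) ri rj).
  have pp' : pg (letter j) = ~~ pg (letter i).
    by move: pp; case: (pg (letter i)); case: (pg (letter j)).
  by rewrite pp' in rj; case: (regions_opposite ri rj).
have oo := letter_parity iN jN ij ll.
have AB := letter_AB iN.
(* The two passages of one letter: by parity one of them is the raised arch. *)
have uc : u.1 = center (letter i).
  rewrite oo in ri; rewrite -ll in rj; rewrite /center.
  by case: (odd j) ri rj => /= ri rj; apply: regions_crossing.
rewrite mu mv -e -ll /mark uc eqxx oo.
have [h1 h2] := heading_transversal (pg (letter i)) (arrival i) (departure i) (arrival j) (departure j).
by case: (odd j).
Qed.

(** The two passages of a letter have opposite parity and the same ends, so they are
    the two parallel arches over these ends and cross exactly once; arches of
    different letters are disjoint or nested, or lie on different sides. *)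
Theorem arch_diagram_realizable (R : realType) : realizable R [seq letter i | i <- iota 0 N].
Proof.
apply: (@lattice_realizable R arch_curve arch_curve_size arch_curve_cycle _ n _ center).
- apply: compatible_crossings; apply: flatten_pairwise.
    by move=> i /andP[_ iN]; exact: piece_pairwise.
  move=> i j u v _ ij jN; apply: piece_compatible => //; first exact: ltn_trans jN.
  by rewrite neq_ltn ij.
- exact: letter_twice.
- have AB x : A x != B x.
    have : x \in [seq letter i | i <- iota 0 N] by rewrite -has_pred1 has_count letter_twice.
    by case/mapP => i; rewrite mem_iota => /andP[_ iN] ->; exact: letter_AB.
  move=> x y; rewrite /center /arch_center => -[e1 e2]; apply/eqP/negPn/negP => xy.
  have := arch_height_gt2 (AB x); have := arch_height_gt2 (AB y).
  have [pp|pp] := boolP (pg x == pg y).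
    by have := noncrossing xy (eqP pp); rewrite /apart; move: e1; lia.
  by move: e2 pp; case: (pg x); case: (pg y) => //= e2 _; lia.
- exact: arch_curve_word.
Qed.

End ArchDiagram.

(** * The search over chord diagrams *)

Section DiagramSearch.
Local Open Scope nat_scope.

(* Comparison by structural recursion: the search evaluates it very often, and it
   reduces faster than the generic one. *)
Fixpoint ltb m n := if n is n'.+1 then if m is m'.+1 then ltb m' n' else true else false.
Definition index_nat x s := find (eqn x) s.
Definition between i j k := ltb i k && ltb k j.
Definition chords F := [seq c <- zip (iota 0 (size F)) F | ltb c.1 c.2].
Definition interlaced (c d : nat * nat) := between c.1 c.2 d.1 (+) between c.1 c.2 d.2.
Definition interlacement_rows F := let cs := chords F in [seq [seq interlaced c d | d <- cs] | c <- cs].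
Definition dot2 (r s : seq bool) := foldr (fun p => addb (p.1 && p.2)) false (zip r s).
Definition even_conditions (M : seq (seq bool)) :=
  all (fun r => all (fun p => p.1 || ~~ dot2 r p.2) (zip r M)) M.
Definition triangle_condition (M : seq (seq bool)) :=
  all (fun r => all (fun p => p.1 ==>
    all (fun q => (q.1.1 && q.1.2) ==> (dot2 r p.2 (+) dot2 r q.2 (+) dot2 p.2 q.2))
        (zip (zip r p.2) M)) (zip r M)) M.
Definition gauss_conditions F :=
  let M := interlacement_rows F in if even_conditions M then triangle_condition M else false.

(** The length of each chord, measured forwards from each of the positions. *)
Definition chord_lengths F :=
  [seq (if ltb c.1 c.2 then c.2 - c.1 else c.2 + size F - c.1) | c <- zip (iota 0 (size F)) F].
Fixpoint lexle (s t : seq nat) : bool :=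
  match s, t with
  | x :: s', y :: t' => if eqn x y then lexle s' t' else ltb x y
  | [::], _ => true
  | _, _ => false
  end.

(** Singles out one base point among the rotations of a diagram. *)
Definition least_rotation (s : seq nat) := all (fun r => lexle s (rot r s)) (iota 0 (size s)).

Definition reverse_segment T p q (s : seq T) := take p s ++ rev (take (q - p) (drop p s)) ++ drop q s.

(** One step of Dehn's algorithm for the letter x: between the two passages the
    curve is reversed.  The first component lists the letters and the second one
    the gaps between consecutive letters, in the current order. *)
Definition switch (st : seq nat * seq nat) x :=
  let p := index_nat x st.1 in let q := index_nat x (drop p.+1 st.1) + p.+1 in
  (reverse_segment p.+1 q st.1, reverse_segment p q st.2).

(** The gaps in the order in which the unfolded, simple closed curve runs through
    them. *)
Definition unfolded_order F :=
  (foldl switch ([seq minn c.1 c.2 | c <- zip (iota 0 (size F)) F], iota 0 (size F))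
         [seq c.1 | c <- chords F]).2.
Definition arch_ends (J : seq nat) i := (arrival (nth 0 J) i, departure (nth 0 J) i).
Definition sort_pair (c : nat * nat) := if ltb c.1 c.2 then c else (c.2, c.1).
Definition uncrossed (c d : nat * nat) :=
  if ltb c.1 d.1 then ltb c.2 d.1 || ltb d.2 c.2 else ltb d.1 c.1 && (ltb d.2 c.1 || ltb c.2 d.2).

(** Backtracking assignment of the chords to two pages.  Nested conditionals stop
    the evaluation of a branch as soon as it fails. *)
Fixpoint two_pages (cs up down : seq (nat * nat)) : bool :=
  if cs is c :: cs' then
    if (if all (uncrossed c) up then two_pages cs' (c :: up) down else false) then true
    else if all (uncrossed c) down then two_pages cs' up (c :: down) else false
  else true.

(** The last gap comes last on the unfolded curve, the two passages of each letter
    have the same ends, and the arches embed in two pages.  By parity every letter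
    has one even position, so the arches at even positions suffice. *)
Definition drawable F :=
  let G := unfolded_order F in let J := [seq index_nat i G | i <- iota 0 (size F)] in
  let E := [seq sort_pair (arch_ends J i) | i <- iota 0 (size F)] in
  let cs := [seq nth (0, 0) E k.*2 | k <- iota 0 (size F)./2] in
  [&& last 0 G == (size F).-1,
      all (fun i => let c := nth (0, 0) E i in let d := nth (0, 0) E (nth 0 F i) in eqn c.1 d.1 && eqn c.2 d.2) (iota 0 (size F))
    & two_pages cs [::] [::]].

(** The partner list of the exceptional word read from its position 13. *)
Definition exceptional_partners :=
  [:: 5; 8; 9; 14; 15; 0; 13; 12; 1; 2; 17; 16; 7; 6; 3; 4; 11; 10].
Definition leaf F :=
  if least_rotation (chord_lengths F) then
    if gauss_conditions F then if F == exceptional_partners then true else drawable F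
    else true
  else true.

Definition join_ends F i j := set_nth 0 (set_nth 0 F i j) j i.

(** Pairs the first free position i with every admissible j: at odd distance, and
    such that neither arc cut off by the chord is shorter than that of the chord
    from position 0.  Free positions hold the out of range value size F. *)
Fixpoint search (check : seq nat -> bool) k i F : bool :=
  if k is k'.+1 then
    if ltb (nth 0 F i) (size F) then search check k' i.+1 F
    else all (fun j =>
      if [&& ~~ ltb (nth 0 F j) (size F), odd (j - i) &
             eqn i 0 || ~~ ltb (j - i) (nth 0 F 0) && ~~ ltb (size F + i) (nth 0 F 0 + j)]
      then search check k' i.+1 (join_ends F i j) else true) (iota i.+1 (size F - i.+1))
  else check F.
Definition search_diagrams N := search leaf N 0 (nseq N N).

End DiagramSearch.

(** * Partner lists of double occurrence words *)

Local Notation "w `[ i ]" := (nth ord0 w i) (at level 2, format "w `[ i ]").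

Section Partners.
Variable n : nat.
Implicit Types (w u v : seq 'I_n.+1) (F : seq nat).

Lemma size_double_occurrence w : double_occurrence w -> size w = (n.+1 * 2)%N.
Proof.
move=> dw; rewrite -sum1_size -[LHS]/(\sum_(x <- w) 1)%N.
rewrite (partition_big id predT) //=.
under eq_bigr => a _ do rewrite sum1_count -[count _ _]/(count_mem a w) dw.
by rewrite sum_nat_const card_ord.
Qed.

Definition partners w F : Prop :=
  size F = size w /\ forall i, (i < size w)%N ->
    [/\ (nth 0 F i < size w)%N, nth 0%N F i != i &
        forall j, (j < size w)%N -> (w`[j] == w`[i]) = (j == i) || (j == nth 0%N F i)].

Lemma filter_positions (P : pred 'I_n.+1) w (s : seq nat) :
  sorted ltn s -> (forall k, (k \in s) = (k < size w)%N && P w`[k]) ->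
  [seq x <- w | P x] = [seq w`[k] | k <- s].
Proof.
move=> s_sorted sP; rewrite -[in LHS](mkseq_nth ord0 w) /mkseq filter_map; congr map.
apply: (irr_sorted_eq ltn_trans ltnn) => //.
  by apply: (sorted_filter ltn_trans); exact: iota_ltn_sorted.
by move=> k; rewrite mem_filter mem_iota sP andbC.
Qed.

Lemma partners_exist w : double_occurrence w -> exists F, partners w F.
Proof.
move=> dw; have [i|f fP] := @choice _ _ (fun i fi => (i < size w)%N ->
    [/\ (fi < size w)%N, fi != i &
        forall j, (j < size w)%N -> (w`[j] == w`[i]) = (j == i) || (j == fi)]).
  have [iw|//] := boolP (i < size w)%N; last by exists 0%N.
  pose s := [seq j <- iota 0 (size w) | w`[j] == w`[i]].
  have sP j : (j \in s) = (j < size w)%N && (w`[j] == w`[i]).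
    by rewrite mem_filter mem_iota andbC.
  have : size s = 2.
    rewrite size_filter -(count_map (nth ord0 w) (pred1 w`[i])) -/(mkseq _ _) mkseq_nth.
    exact: dw.
  have : uniq s by rewrite filter_uniq ?iota_uniq.
  have := sP i; rewrite iw eqxx; case: s sP => [|a [|b [|//]]] // sP.
  rewrite /= !inE andbT => /orP[/eqP ia|/eqP ib] ab _.
  - exists b => _; have := sP b; rewrite !inE eqxx orbT => /esym/andP[bw _].
    by split=> // [|j jw]; [rewrite ia eq_sym | have := sP j; rewrite !inE jw -ia].
  - exists a => _; have := sP a; rewrite !inE eqxx => /esym/andP[aw _].
    split=> // [|j jw]; first by rewrite ib.
    by have := sP j; rewrite !inE jw -ib orbC.
exists (mkseq f (size w)); split; first by rewrite size_mkseq.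
by move=> i iw; rewrite nth_mkseq //; exact: fP.
Qed.

Section PartnerFacts.
Variables (w : seq 'I_n.+1) (F : seq nat).
Hypotheses (dw : double_occurrence w) (wF : partners w F).
Local Notation N := (size w).
Local Notation f i := (nth 0%N F i).

Lemma partner_lt i : (i < N)%N -> (f i < N)%N. Proof. by case/(wF.2). Qed.
Lemma partner_neq i : (i < N)%N -> f i != i. Proof. by case/(wF.2). Qed.
Lemma partner_eq i j : (i < N)%N -> (j < N)%N -> (w`[j] == w`[i]) = (j == i) || (j == f i).
Proof. by case/(wF.2) => _ _; apply. Qed.

Lemma partner_letter i : (i < N)%N -> w`[f i] = w`[i].
Proof. by move=> iN; apply/eqP; rewrite partner_eq ?partner_lt // eqxx orbT. Qed.

Lemma partnerK i : (i < N)%N -> f (f i) = i.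
Proof.
move=> iN; have fN := partner_lt iN.
have /esym := partner_eq fN iN; rewrite partner_letter // eqxx.
case/orP => /eqP // h; have := partner_neq iN; by rewrite -h eqxx.
Qed.

Lemma partners_perm : perm_eq F (iota 0 N).
Proof.
rewrite -[F](mkseq_nth 0%N) wF.1 /mkseq; apply: uniq_perm; rewrite ?iota_uniq //.
  rewrite map_inj_in_uniq ?iota_uniq // => i j.
  by rewrite !mem_iota => iN jN h; rewrite -(partnerK iN) h partnerK.
move=> j; rewrite mem_iota; apply/mapP/idP => [[i + ->]|jN].
  by rewrite mem_iota; exact: partner_lt.
by exists (f j); rewrite ?mem_iota ?partner_lt // partnerK.
Qed.

Lemma letter_opener a : exists i, [/\ (i < N)%N, (i < f i)%N & w`[i] = a].
Proof.
have aw : a \in w by rewrite -has_pred1 has_count dw.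
have iN : (index a w < N)%N by rewrite index_mem.
have := partner_neq iN; rewrite neq_ltn => /orP[h|h].
  by exists (f (index a w)); rewrite partner_lt // partner_letter // partnerK // nth_index.
by exists (index a w); rewrite nth_index.
Qed.

End PartnerFacts.
End Partners.

(** * Interlacement read off the partner list *)

Lemma ltbE m p : ltb m p = (m < p)%N.
Proof. by elim: p m => [|p IH] [|m] //=; rewrite IH. Qed.

Lemma eqnE (m p : nat) : eqn m p = (m == p). Proof. by []. Qed.

Lemma zip_iota F : zip (iota 0 (size F)) F = [seq (i, nth 0%N F i) | i <- iota 0 (size F)].
Proof.
rewrite -[in LHS](mkseq_nth 0%N F) size_mkseq /mkseq -[in X in zip X](map_id (iota 0 _)).
by rewrite zip_map.
Qed.

Lemma chordsE F : chords F = [seq (i, nth 0 F i) | i <- iota 0 (size F) & (i < nth 0 F i)%N].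
Proof.
rewrite /chords zip_iota filter_map; congr map; apply: eq_filter => i /=.
by rewrite ltbE.
Qed.

Definition interlacing_row cs c := [seq interlaced c d | d <- cs].

Lemma even_conditionsE F : even_conditions (interlacement_rows F) =
  all (fun c => all (fun d => interlaced c d ||
    ~~ dot2 (interlacing_row (chords F) c) (interlacing_row (chords F) d)) (chords F)) (chords F).
Proof.
rewrite /even_conditions /interlacement_rows all_map; apply: eq_all => c /=.
by rewrite zip_map all_map.
Qed.

Lemma triangle_conditionE F : triangle_condition (interlacement_rows F) =
  all (fun c => all (fun d => interlaced c d ==> all (fun e => interlaced c e && interlaced d e ==>
    (dot2 (interlacing_row (chords F) c) (interlacing_row (chords F) d)
       (+) dot2 (interlacing_row (chords F) c) (interlacing_row (chords F) e)
       (+) dot2 (interlacing_row (chords F) d) (interlacing_row (chords F) e)))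
    (chords F)) (chords F)) (chords F).
Proof.
rewrite /triangle_condition /interlacement_rows all_map; apply: eq_all => c /=.
rewrite zip_map all_map; apply: eq_all => d /=; congr implb.
by rewrite !zip_map all_map.
Qed.

Lemma dot2_sum (T : Type) (f g : T -> bool) s :
  dot2 [seq f x | x <- s] [seq g x | x <- s] = odd (\sum_(x <- s) f x * g x).
Proof.
rewrite /dot2 zip_map; elim: s => [|x s IH] /=; first by rewrite big_nil.
by rewrite big_cons IH oddD oddM !oddb.
Qed.

Section Interlacement.
Variables (n : nat) (w : seq 'I_n.+1) (F : seq nat).
Hypotheses (dw : double_occurrence w) (wF : partners w F).
Local Notation N := (size w).
Local Notation f i := (nth 0%N F i).

Lemma mem_chords i j : ((i, j) \in chords F) = [&& (i < N)%N, (i < j)%N & j == f i].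
Proof.
rewrite chordsE wF.1; apply/mapP/and3P => [[k] | [iN ij /eqP jE]].
  by rewrite mem_filter mem_iota => /andP[kF kN] [-> ->].
by exists i; rewrite ?jE // mem_filter mem_iota -jE ij.
Qed.

(** The four endpoints may come in six orders; the letters alternate in two of them. *)
Lemma chords_intersect_interlaced c d : c \in chords F -> d \in chords F ->
  chords_intersect w w`[c.1] w`[d.1] = interlaced c d.
Proof.
case: c d => [i i'] [j j']; rewrite !mem_chords => /and3P[iN ii' /eqP i'E] /and3P[jN jj' /eqP j'E] /=.
have i'N : (i' < N)%N by rewrite i'E (partner_lt wF).
have j'N : (j' < N)%N by rewrite j'E (partner_lt wF).
have wi' : w`[i'] = w`[i] by rewrite i'E (partner_letter wF).
have wj' : w`[j'] = w`[j] by rewrite j'E (partner_letter wF).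
rewrite /chords_intersect /interlaced /between /= !ltbE.
have [eij|nij] := eqVneq w`[i] w`[j].
  have /esym := partner_eq wF jN iN; rewrite eij eqxx -j'E /= => /orP[]/eqP hi; last first.
    have := partnerK wF jN; rewrite -j'E -hi -i'E => h; move: ii' jj'; rewrite h hi; lia.
  by move: i'E; rewrite hi -j'E => ->; rewrite !ltnn andbF.
rewrite /=.
have i_j : i != j by apply: contraNneq nij => ->.
have i_j' : i != j' by apply: contraNneq nij => ->; rewrite wj'.
have i'_j : i' != j by apply: contraNneq nij => h; rewrite -wi' h.
have i'_j' : i' != j' by apply: contraNneq nij => h; rewrite -wi' -wj' h.
have main (s : seq nat) : sorted ltn s -> perm_eq s [:: i; i'; j; j'] ->
    [seq x <- w | (x == w`[i]) || (x == w`[j])] = [seq w`[k] | k <- s].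
  move=> s_sorted s_perm; apply: filter_positions => // k.
  rewrite (perm_mem s_perm) !inE; have [kN|kN] := ltnP k N.
    by rewrite (partner_eq wF) // (partner_eq wF) // -i'E -j'E orbA.
  by apply/negbTE; lia.
have nji : (w`[j] == w`[i]) = false by rewrite eq_sym (negbTE nij).
have e := (wi', wj', negbTE nij, nji).
have perm (s : seq nat) : uniq s -> (forall k, (k \in s) = [|| k == i, k == i', k == j | k == j']) ->
    perm_eq s [:: i; i'; j; j'].
  move=> us sP; apply: uniq_perm => // [|k]; last by rewrite sP !inE.
  by rewrite /= !inE; lia.
have [ij|ij] := ltnP i j; have [ij'|ij'] := ltnP i j'; have [i'j|i'j] := ltnP i' j;
  have [i'j'|i'j'] := ltnP i' j'; try lia.
- rewrite (main [:: i; i'; j; j']) /= ?ij ?i'j ?inE ?eqseq_cons ?e ?eqxx; first lia.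
    by clear -ij ij' i'j i'j' ii' jj' i_j i_j' i'_j i'_j'; lia.
  by apply: perm => [|k]; rewrite /= ?inE; lia.
- rewrite (main [:: i; j; i'; j']) /= ?ij ?i'j ?inE ?eqseq_cons ?e ?eqxx; first lia.
    by clear -ij ij' i'j i'j' ii' jj' i_j i_j' i'_j i'_j'; lia.
  by apply: perm => [|k]; rewrite /= ?inE; lia.
- rewrite (main [:: i; j; j'; i']) /= ?ij ?i'j ?inE ?eqseq_cons ?e ?eqxx; first lia.
    by clear -ij ij' i'j i'j' ii' jj' i_j i_j' i'_j i'_j'; lia.
  by apply: perm => [|k]; rewrite /= ?inE; lia.
- rewrite (main [:: j; i; i'; j']) /= ?ij ?i'j ?inE ?eqseq_cons ?e ?eqxx; first lia.
    by clear -ij ij' i'j i'j' ii' jj' i_j i_j' i'_j i'_j'; lia.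
  by apply: perm => [|k]; rewrite /= ?inE; lia.
- rewrite (main [:: j; i; j'; i']) /= ?ij ?i'j ?inE ?eqseq_cons ?e ?eqxx; first lia.
    by clear -ij ij' i'j i'j' ii' jj' i_j i_j' i'_j i'_j'; lia.
  by apply: perm => [|k]; rewrite /= ?inE; lia.
- rewrite (main [:: j; j'; i; i']) /= ?ij ?i'j ?inE ?eqseq_cons ?e ?eqxx; first lia.
    by clear -ij ij' i'j i'j' ii' jj' i_j i_j' i'_j i'_j'; lia.
  by apply: perm => [|k]; rewrite /= ?inE; lia.
Qed.

End Interlacement.

Section Conditions.
Variables (n : nat) (w : seq 'I_n.+1) (F : seq nat).
Hypotheses (dw : double_occurrence w) (wF : partners w F).
Local Notation N := (size w).
Local Notation f i := (nth 0%N F i).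

Lemma chord_sum (g : nat * nat -> nat) :
  (\sum_(c <- chords F) g c = \sum_(i <- iota 0 N | i < f i) g (i, f i))%N.
Proof. by rewrite chordsE big_map big_filter wF.1. Qed.

(** Every letter has exactly one opening position, so sums over the letters are
    sums over the chords. *)
Lemma chord_letters : perm_eq [seq w`[c.1] | c <- chords F] (index_enum 'I_n.+1).
Proof.
apply: uniq_perm; rewrite ?index_enum_uniq //.
  rewrite map_inj_in_uniq => [|[i i'] [j j']].
    by rewrite chordsE map_inj_uniq ?filter_uniq ?iota_uniq // => i j [].
  rewrite !(mem_chords wF) /= => /and3P[iN ii' /eqP i'E] /and3P[jN jj' /eqP j'E] /eqP.
  rewrite (partner_eq wF) // -j'E => /orP[]/eqP h; first by rewrite i'E j'E h.
  have := partnerK wF jN; rewrite -j'E -h -i'E => h'; move: ii' jj'; rewrite h h'; lia.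
move=> a; rewrite mem_index_enum; apply/mapP.
have [i [iN ifi <-]] := letter_opener dw wF a.
by exists (i, f i); rewrite // (mem_chords wF) iN ifi eqxx.
Qed.

Lemma row_dot_chords c d : c \in chords F -> d \in chords F ->
  row_dot (interlacement_mx w) w`[c.1] w`[d.1] =
  (\sum_(e <- chords F) interlaced c e * interlaced d e)%N.
Proof.
move=> cF dF; rewrite /row_dot -(perm_big _ chord_letters) big_map big_seq [RHS]big_seq.
by apply: eq_bigr => e eF; rewrite !mxE !(chords_intersect_interlaced wF).
Qed.

Lemma odd_row_dot c d : c \in chords F -> d \in chords F ->
  odd (row_dot (interlacement_mx w) w`[c.1] w`[d.1]) =
  dot2 (interlacing_row (chords F) c) (interlacing_row (chords F) d).
Proof. by move=> cF dF; rewrite row_dot_chords // dot2_sum. Qed.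

Lemma opening_chord a : exists2 c, c \in chords F & w`[c.1] = a.
Proof.
have [i [iN ifi <-]] := letter_opener dw wF a.
by exists (i, f i); rewrite // (mem_chords wF) iN ifi eqxx.
Qed.

(** The evenness condition on pairs of chords includes equal ones, since a chord
    does not intersect itself; that case is condition1. *)
Lemma conditionsP : condition1 w /\ condition2 w /\ condition3 w <-> gauss_conditions F.
Proof.
rewrite /gauss_conditions /= even_conditionsE triangle_conditionE -[if _ then _ else _]/(_ && _).
split=> [[c1 [c2 c3]] | /andP[/allP even /allP triangle]].
  apply/andP; split; apply/allP => c cF; apply/allP => d dF.
    case: (boolP (interlaced c d)) => //= ncd; rewrite -odd_row_dot // -dvdn2 /dvdn.
    have [->|wcd] := eqVneq w`[c.1] w`[d.1]; first by apply/eqP; exact: c1.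
    by apply/eqP/c2 => //; rewrite (chords_intersect_interlaced wF).
  apply/implyP => cd; apply/allP => e eF; apply/implyP => /andP[ce de].
  rewrite -!odd_row_dot // -!oddD.
  have := c3 w`[c.1] w`[d.1] w`[e.1]; rewrite !(chords_intersect_interlaced wF) // => /(_ cd ce de).
  by rewrite !modn2; case: odd.
have dot0 a b : ~~ chords_intersect w a b -> row_dot (interlacement_mx w) a b = 0 %[mod 2].
  have [[c cF <-] [d dF <-]] := (opening_chord a, opening_chord b).
  rewrite (chords_intersect_interlaced wF) // => ncd.
  have /allP/(_ d dF) := even c cF; rewrite (negbTE ncd) /= -odd_row_dot // !modn2.
  by move/negbTE => ->.
split; [|split] => [a|a b _|a b e].
- by apply: dot0; rewrite /chords_intersect eqxx.
- exact: dot0.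
have [[x xF <-] [y yF <-] [z zF <-]] := And3 (opening_chord a) (opening_chord b) (opening_chord e).
rewrite !(chords_intersect_interlaced wF) // => xy xz yz.
have /allP/(_ y yF) := triangle x xF; rewrite xy => /allP/(_ z zF).
by rewrite xz yz /= -!odd_row_dot // -!oddD !modn2 => ->.
Qed.

Lemma count_between i j : (i <= j)%N -> (j <= N)%N ->
  (\sum_(k <- iota 0 N) between i j k = j - i.+1)%N.
Proof.
move=> ij jN; rewrite -[j in RHS](minn_idPl jN); move: N => m {jN}.
elim: m => [|m IH]; first by rewrite big_nil minn0.
rewrite -addn1 iotaD big_cat big_seq1 /= IH /between !ltbE; lia.
Qed.

(** The positions strictly between the ends of a chord number, modulo 2, the chords
    that it intersects: a chord with both ends or no end inside contributes an
    even number. *)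
Lemma partner_parity i : condition1 w -> (i < N)%N -> odd (f i + i).
Proof.
move=> c1 iN; wlog ifi : i iN / (i < f i)%N => [hw|].
  have := partner_neq wF iN; rewrite neq_ltn orbC => /orP[|h]; first exact: hw.
  by rewrite addnC -[X in (X + _)%N](partnerK wF iN); apply: hw; rewrite ?(partner_lt wF) ?(partnerK wF).
have cF : (i, f i) \in chords F by rewrite (mem_chords wF) iN ifi eqxx.
suff : ~~ odd (f i - i.+1) by move: ifi; lia.
rewrite -(count_between (ltnW ifi) (ltnW (partner_lt wF iN))).
have -> : (\sum_(k <- iota 0 N) between i (f i) k = \sum_(c <- chords F)
   (between i (f i) c.1 + between i (f i) c.2))%N.
  rewrite (bigID (fun k => k < f k)%N) /= big_split /=; congr addn; first by rewrite chord_sum.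
  rewrite -(perm_big _ (partners_perm wF)) -[X in \sum_(k <- X | _) _](mkseq_nth 0%N).
  rewrite /mkseq wF.1 big_map chord_sum big_seq_cond [RHS]big_seq_cond; apply: eq_bigl => k.
  rewrite mem_iota; have [kN|//] := boolP (k < N)%N; rewrite (partnerK wF kN) /=.
  by have := partner_neq wF kN; lia.
have := c1 w`[i]; rewrite (row_dot_chords cF cF) !modn2.
have -> : odd (\sum_(e <- chords F) interlaced (i, f i) e * interlaced (i, f i) e)%N =
  odd (\sum_(c <- chords F) (between i (f i) c.1 + between i (f i) c.2))%N.
  rewrite !(@big_morph _ _ odd false addb 0%N addn oddD erefl).
  by apply: eq_bigr => c _; rewrite oddM andbb oddD !oddb.
by case: odd.
Qed.
End Conditions.

(** * Completeness of the search *)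

Lemma nth_join_ends F i j k :
  nth 0%N (join_ends F i j) k = if k == j then i else if k == i then j else nth 0%N F k.
Proof. by rewrite /join_ends !nth_set_nth /= nth_set_nth /=. Qed.

Lemma size_join_ends F i j : (i < size F)%N -> (j < size F)%N ->
  size (join_ends F i j) = size F.
Proof. by move=> iF jF; rewrite /join_ends !size_set_nth; lia. Qed.

(** The partial pairing f agrees with F where it is defined, is closed under F, and
    is defined before i; the branch that follows F is among those searched. *)
Lemma search_complete (check : seq nat -> bool) (F : seq nat) k i (f : seq nat) :
  let N := size F in
  (forall x, (x < N)%N -> [/\ (nth 0 F x < N)%N, nth 0%N F (nth 0%N F x) = x &
     odd (nth 0 F x + x)]) ->
  (forall x, (x < N)%N -> (x < nth 0 F x)%N ->
     (nth 0 F 0 <= nth 0 F x - x)%N && (nth 0 F 0 <= N + x - nth 0 F x)%N) ->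
  (k + i)%N = N -> size f = N ->
  (forall x, (x < N)%N -> nth 0%N f x = nth 0%N F x /\ nth 0%N f (nth 0%N F x) = x \/
     nth 0%N f x = N /\ (i <= x)%N) ->
  search check k i f -> check F.
Proof.
move=> N inv short; elim: k i f => [|k IH] i f kiN sf ff /=.
  suff -> : f = F by [].
  apply: (eq_from_nth (x0 := 0%N)) => // x; rewrite sf => xN.
  by have := ff x xN; lia.
rewrite !ltbE sf; have iN : (i < N)%N by lia.
have [jN jK ij_odd] := inv i iN.
have [[fi fj]|[fi _]] := ff i iN.
  rewrite fi jN; apply: (IH i.+1 f) => //; first by lia.
  move=> x xN; have [|[fx ix]] := ff x xN; [by left | right; split=> //].
  by have : x != i; [apply: contraTneq jN => xi; rewrite -fi -xi fx ltnn | lia].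
rewrite fi ltnn => /allP; set j := nth 0%N F i in jN jK ij_odd * => h.
(* The partner of a free position is free, and lies further on. *)
have fj : nth 0%N f j = N /\ (i <= j)%N.
  have [[_ h2]|//] := ff j jN.
  by move: h2; rewrite jK fi => h2; move: jN; rewrite -h2 ltnn.
have ij : (i < j)%N by have : i != j; [apply/eqP => h1; move: ij_odd; rewrite -/j -h1; lia | lia].
have := h j; rewrite mem_iota !ltbE fj.1 ltnn eqnE.
have -> : [&& ~~ false, odd (j - i) & (i == 0%N) || ~~ (j - i < nth 0 f 0)%N && ~~ (N + i < nth 0 f 0 + j)%N].
  apply/and3P; split=> //; first by lia.
  have [->//|i0] := eqVneq i 0%N; have [|] := ff 0%N (leq_ltn_trans (leq0n _) iN); last by lia.
  by case=> -> _; have := short i iN ij; rewrite -/j; lia.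
move=> /(_ ltac:(lia)); apply: IH; [by lia | by rewrite size_join_ends sf|].
move=> x xN; rewrite !nth_join_ends.
have [->|xj] := eqVneq x j; first by left; rewrite jK eqxx; case: eqP; lia.
have [->|xi] := eqVneq x i; first by left; rewrite -/j eqxx.
have [[fx fFx]|[fx ix]] := ff x xN; last by right; lia.
left; split=> //; have [_ xK _] := inv x xN.
case: eqP => [h1|_]; first by move: xi; rewrite -xK h1 jK eqxx.
by case: eqP => [h1|//]; move: xj; rewrite -xK h1 eqxx.
Qed.

(** The comparison is the lexicographic order, hence a total order. *)
Lemma lexleE s t : lexle s t = ((s : seqlexi nat) <= (t : seqlexi nat))%O.
Proof.
elim: s t => [|x s IH] [|y t] //=.
rewrite eqnE ltbE lexi_cons -IH.
by rewrite !leEnat; case: ltngtP => //=; rewrite ?implybT ?andbT.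
Qed.

Lemma least_rotation_exists (s : seq nat) : (0 < size s)%N ->
  exists2 r, (r < size s)%N & least_rotation (rot r s).
Proof.
case: {2}(size s) (erefl (size s)) => [->//|m sE] _.
(* A least element among the finitely many rotations. *)
pose t (r : 'I_m.+1) : seqlexi nat := rot r s.
have [r _ rP] := arg_minP t (erefl : predT (ord0 : 'I_m.+1)).
have {t}rP q : (q < m.+1)%N -> lexle (rot r s) (rot q s).
  by move=> qm; rewrite lexleE; exact: (rP (Ordinal qm)).
have := ltn_ord r; move: (nat_of_ord r) rP => {}r rP rm.
exists r; rewrite ?sE // /least_rotation size_rot; apply/allP => q.
rewrite sE mem_iota => /andP[_ qm].
have -> : rot q (rot r s) = rot (if (q + r < size s)%N then q + r else q + r - size s)%N s.
  rewrite rot_add_mod ?sE ?(ltnW rm) ?(ltnW qm) //.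
  have [->|] := eqVneq (q + r)%N m.+1; last by case: ltngtP.
  by rewrite leqnn ltnn subnn rot0 -sE rot_size.
by apply: rP; rewrite sE; case: ifP; lia.
Qed.

Lemma nth_chord_lengths F i : (i < size F)%N -> nth 0%N (chord_lengths F) i =
  (if i < nth 0 F i then nth 0 F i - i else nth 0 F i + size F - i)%N.
Proof.
move=> iF; rewrite /chord_lengths zip_iota -map_comp (nth_map 0%N) ?size_iota //=.
by rewrite nth_iota // add0n ltbE.
Qed.

Lemma size_chord_lengths F : size (chord_lengths F) = size F.
Proof. by rewrite size_map size_zip size_iota minnn. Qed.

Lemma nth_rot_lt (T : Type) (x0 : T) k i (s : seq T) : (k <= size s)%N -> (i < size s)%N ->
  nth x0 (rot k s) i = nth x0 s (if i + k < size s then i + k else i + k - size s)%N.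
Proof.
move=> ks ies; rewrite nth_rot //; case: ltnP => h; first by rewrite modn_small.
by rewrite -{1}(subnK h) modnDr modn_small //; lia.
Qed.

Section Rotation.
Variable n : nat.
Implicit Types (w : seq 'I_n.+1) (F : seq nat).

(** Chord lengths do not depend on the base point, so the lists of lengths are
    rotated along with the words. *)
Lemma chord_lengths_rot w F F' r : partners w F -> partners (rot r w) F' ->
  (r < size w)%N -> chord_lengths F' = rot r (chord_lengths F).
Proof.
move=> wF wF' rN; have sF' : size F' = size w by rewrite wF'.1 size_rot.
apply: (eq_from_nth (x0 := 0%N)); rewrite ?size_rot !size_chord_lengths ?wF.1 //.
move=> i; rewrite sF' => iN; rewrite nth_rot_lt ?size_chord_lengths ?wF.1 ?(ltnW rN) //.
set x := (if _ then _ else _); have xN : (x < size w)%N by rewrite /x; case: ifP; lia.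
rewrite !nth_chord_lengths ?sF' ?wF.1 //.
have fx := partner_lt wF xN; have fx_x := partner_neq wF xN.
have fx_w := partner_letter wF xN; set y := nth 0%N F x in fx fx_x fx_w *.
(* The place of the partner y after the rotation. *)
pose j := (if r <= y then y - r else y + size w - r)%N.
have jN : (j < size w)%N by rewrite /j; case: ifP; lia.
have i'N : (i < size (rot r w))%N by rewrite size_rot.
have : (rot r w)`[j] == (rot r w)`[i].
  rewrite !nth_rot_lt ?(ltnW rN) // -/x -fx_w; apply/eqP; congr nth.
  by rewrite /j; case: (leqP r y) => ?; case: ltnP => ?; lia.
rewrite (partner_eq wF' i'N) ?size_rot // => /orP[/eqP ji|/eqP <-].
  by move: ji fx_x; rewrite /x /j; case: (leqP r y) => ?; case: ltnP => ?; lia.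
rewrite /x /j in fx_x *; move: fx_x; case: (leqP r y) => ?; case: (ltnP (i + r) _) => ? fx_x; case: ltnP => ?; case: ltnP => ?; lia.
Qed.

Lemma rot_double_occurrence w r : double_occurrence w -> double_occurrence (rot r w).
Proof. by move=> dw a; rewrite -(dw a); apply/seq.permP; rewrite perm_rot. Qed.

Lemma canonical_rotation w : double_occurrence w ->
  exists r F, partners (rot r w) F /\ least_rotation (chord_lengths F).
Proof.
move=> dw; have [F wF] := partners_exist dw.
have [|r rN rP] := @least_rotation_exists (chord_lengths F).
  by rewrite size_chord_lengths wF.1 size_double_occurrence.
have [F' wF'] := partners_exist (rot_double_occurrence r dw).
rewrite size_chord_lengths wF.1 in rN.
by exists r, F'; split=> //; rewrite (chord_lengths_rot wF wF' rN).
Qed.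

Lemma lexle_head (s t : seq nat) : (0 < size t)%N -> lexle s t -> (nth 0 s 0 <= nth 0 t 0)%N.
Proof.
case: s t => [|x s] [|y t] //= _; rewrite eqnE ltbE.
by case: eqP => [->//|_]; exact: ltnW.
Qed.

(** The first entry of the least rotation is the least of all chord lengths, which is
    the bound that prunes the search. *)
Lemma least_rotation_short w F i : partners w F -> least_rotation (chord_lengths F) ->
  (i < size w)%N -> (i < nth 0 F i)%N ->
  (nth 0 F 0 <= nth 0 F i - i)%N && (nth 0 F 0 <= size w + i - nth 0 F i)%N.
Proof.
move=> wF; rewrite /least_rotation size_chord_lengths wF.1 => /allP least iN ifi.
have first x : (x < size w)%N -> (nth 0 F 0 <= nth 0 (chord_lengths F) x)%N.
  move=> xN; have := least x; rewrite mem_iota xN => /(_ erefl)/lexle_head.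
  have N0 := leq_ltn_trans (leq0n _) xN.
  rewrite size_rot nth_rot_lt ?size_chord_lengths ?wF.1 ?(ltnW xN) // add0n xN.
  rewrite nth_chord_lengths ?wF.1 // subn0.
  have : nth 0%N F 0 != 0%N := partner_neq wF N0.
  by move=> f0 /(_ N0); case: ltnP; lia.
have fN := partner_lt wF iN.
have := first i iN; have := first _ fN; rewrite !nth_chord_lengths ?wF.1 // (partnerK wF) // ifi.
by case: ltnP; lia.
Qed.

Lemma leaf_reached w F N : search_diagrams N -> double_occurrence w -> size w = N -> partners w F ->
  condition1 w -> least_rotation (chord_lengths F) -> leaf F.
Proof.
move=> searchN dw sw wF c1 least; have sF : size F = N by rewrite wF.1.
apply: (search_complete (F := F)) searchN => //; rewrite ?sF ?size_nseq ?addn0 -?sw //.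
- move=> x xN; split; [exact: partner_lt | exact: (partnerK wF) | exact: partner_parity].
- by move=> x xN; apply: least_rotation_short.
- by move=> x xN; right; rewrite nth_nseq xN.
Qed.
End Rotation.

(** * Invariance under equivalence of Gauss diagrams *)

Lemma rot_rot_exists (T : Type) k l (s : seq T) : exists m, rot k (rot l s) = rot m s.
Proof.
have small (t : seq T) j : exists2 i, (i <= size t)%N & rot j t = rot i t.
  have [h|h] := leqP j (size t); first by exists j.
  by exists 0%N; rewrite // rot0 rot_oversize // ltnW.
have [i ks ->] := small (rot l s) k; have [j ls hl] := small s l.
by rewrite size_rot hl in ks *; rewrite rot_add_mod //; eexists.
Qed.

Section Equivalence.
Variable n : nat.
Implicit Types (w u v : seq 'I_n).

Lemma gauss_equiv_trans u v w : gauss_equiv u v -> gauss_equiv v w -> gauss_equiv u w.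
Proof.
have perm_comp (s t : 'S_n) (z : seq 'I_n) : map t (map s z) = map (s * t)%g z.
  by rewrite -map_comp; apply: eq_map => x; rewrite /= permM.
case=> s [k hv] [t [l hw]].
have [b [m ->]] : exists (b : bool) m, w = rot m (if b then rev (map (s * t)%g u) else map (s * t)%g u).
  rewrite -perm_comp; case: hv => ->{v} in hw; case: hw => ->.
  - by exists false; rewrite map_rot; exact: rot_rot_exists.
  - by exists true; rewrite map_rot rev_rot /rotr; exact: rot_rot_exists.
  - by exists true; rewrite map_rot map_rev; exact: rot_rot_exists.
  - by exists false; rewrite map_rot map_rev rev_rot revK /rotr; exact: rot_rot_exists.
by exists (s * t)%g, m; case: b; [right | left].
Qed.

Lemma gauss_equiv_relabel (s : 'S_n) w : gauss_equiv w (map s w).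
Proof. by exists s, 0%N; left; rewrite rot0. Qed.

Lemma gauss_equiv_rot k w : gauss_equiv w (rot k w).
Proof. by exists 1%g, k; left; rewrite (eq_map (@perm1 _)) map_id. Qed.

Lemma gauss_equiv_unrot k w : gauss_equiv (rot k w) w.
Proof. by rewrite -[X in gauss_equiv _ X](rotK k w); exact: gauss_equiv_rot. Qed.

(** Relabellings, reversals and shifts by one letter generate the equivalence. *)
Lemma gauss_equiv_ind (P : seq 'I_n -> Prop) u v : gauss_equiv u v ->
  (forall (s : 'S_n) w, P w -> P (map s w)) -> (forall w, P w -> P (rev w)) ->
  (forall a w, P (a :: w) -> P (rcons w a)) -> P u -> P v.
Proof.
move=> [s [k uv]] Pmap Prev Prcons Pu.
have Prot m w : P w -> P (rot m w).
  have [h|h] := leqP m (size w); last by rewrite rot_oversize // ltnW.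
  elim: m h => [|m IH] h Pw; first by rewrite rot0.
  rewrite rotS //; have := IH (ltnW h) Pw; case: (rot m w) => // a t; rewrite rot1_cons; exact: Prcons.
by case: uv => ->; apply: Prot; [|apply: Prev]; exact: Pmap.
Qed.

Lemma chords_intersect_map (s : 'S_n) w i j :
  chords_intersect (map s w) (s i) (s j) = chords_intersect w i j.
Proof.
rewrite /chords_intersect (inj_eq perm_inj); congr andb.
rewrite filter_map (eq_filter (a2 := fun x => (x == i) || (x == j))); last first.
  by move=> x /=; rewrite !(inj_eq perm_inj).
by rewrite -!/(map s [:: _; _; _; _]) !inE !(inj_eq (inj_map perm_inj)).
Qed.

Lemma chords_intersect_rev w i j : chords_intersect (rev w) i j = chords_intersect w i j.
Proof.
rewrite /chords_intersect filter_rev; congr andb.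
by rewrite !inE -[[:: i; j; _; _]]/(rev [:: j; i; j; i]) -[X in _ || (_ == X)]/(rev [:: i; j; i; j])
  !(inj_eq (can_inj revK)) orbC.
Qed.

Lemma chords_intersect_rcons a w i j :
  chords_intersect (rcons w a) i j = chords_intersect (a :: w) i j.
Proof.
rewrite /chords_intersect filter_rcons /=; case: ifP => // /orP aij.
have [//|ij] := eqVneq i j; rewrite /= !inE.
have last4 x y t : (rcons t a == [:: x; y; x; y]) = (t == [:: x; y; x]) && (a == y).
  by rewrite -eqseq_rcons.
rewrite !last4 !(eqseq_cons a); have ji : (j == i) = false by rewrite eq_sym (negbTE ij).
by case: aij => /eqP ->; rewrite eqxx ?(negbTE ij) ?ji ?andbT ?andbF ?orbF.
Qed.

Definition even_interlacement w := condition1 w /\ condition2 w /\ condition3 w.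

Lemma row_dot_map (s : 'S_n) w i j :
  row_dot (interlacement_mx (map s w)) (s i) (s j) = row_dot (interlacement_mx w) i j.
Proof.
rewrite /row_dot (reindex_inj (@perm_inj _ s)); apply: eq_bigr => k _.
by rewrite !mxE !chords_intersect_map.
Qed.

Lemma eq_even_interlacement u v : chords_intersect u =2 chords_intersect v ->
  even_interlacement u -> even_interlacement v.
Proof.
move=> uv; rewrite /even_interlacement /condition1 /condition2 /condition3.
have -> : interlacement_mx v = interlacement_mx u by apply/matrixP => i j; rewrite !mxE uv.
move=> [c1 [c2 c3]]; split=> //; split=> [i j|i j k]; rewrite -!uv; [exact: c2 | exact: c3].
Qed.

Lemma even_interlacement_equiv u v : gauss_equiv u v -> even_interlacement u -> even_interlacement v.
Proof.
move=> uv; apply: (gauss_equiv_ind uv) => [s w [c1 [c2 c3]]|w|a w].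
- split; [|split] => [i|i j|i j k]; rewrite -[i](permKV s) ?row_dot_map //.
  + by rewrite -[j](permKV s) (inj_eq perm_inj) chords_intersect_map row_dot_map; exact: c2.
  + rewrite -[j](permKV s) -[k](permKV s) !chords_intersect_map !row_dot_map; exact: c3.
- by apply: eq_even_interlacement => i j; rewrite chords_intersect_rev.
- by apply: eq_even_interlacement => i j; rewrite chords_intersect_rcons.
Qed.

Lemma realizable_equiv (R : realType) u v : gauss_equiv u v -> realizable R v -> realizable R u.
Proof.
move=> uv [g [w [gg gw vw]]]; exists g, w; split=> //; exact: gauss_equiv_trans vw.
Qed.
End Equivalence.

Section SamePartners.
Variable n : nat.
Implicit Types (w u v : seq 'I_n.+1) (F : seq nat).

(** Sending the i-th letter of u to the i-th letter of v is a bijection. *)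
Lemma same_partners u v F : double_occurrence u -> double_occurrence v ->
  partners u F -> partners v F -> exists s : 'S_n.+1, v = map s u.
Proof.
move=> du dv uF vF; have uv : size u = size v by rewrite -uF.1 vF.1.
pose s a := v`[index a u].
have su a : (index a u < size u)%N by rewrite index_mem -has_pred1 has_count du.
have s_nth i : (i < size u)%N -> s u`[i] = v`[i].
  move=> iu; apply/eqP; rewrite (partner_eq vF) -?uv // -(partner_eq uF) //.
  by rewrite nth_index // mem_nth.
have s_inj : injective s.
  move=> a b /eqP; rewrite (partner_eq vF) -?uv // -(partner_eq uF) // !nth_index.
  - by move/eqP.
  - by rewrite -index_mem.
  - by rewrite -index_mem.
exists (perm s_inj); apply: (eq_from_nth (x0 := ord0)); rewrite ?size_map // -uv => i iu.
by rewrite (nth_map ord0) // permE s_nth.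
Qed.
End SamePartners.

(** * Pairings accepted by the planarity test are realizable *)

Lemma index_natE x s : index_nat x s = index x s.
Proof. by apply: eq_find => y; rewrite /= eqnE eq_sym. Qed.

Lemma reverse_segment_perm (T : eqType) p q (s : seq T) : (p <= q)%N ->
  perm_eq (reverse_segment p q s) s.
Proof.
move=> pq; rewrite /reverse_segment; have -> : drop q s = drop (q - p) (drop p s) by rewrite drop_drop subnK.
rewrite -[X in perm_eq _ X](cat_take_drop p s) perm_cat2l.
rewrite -[X in perm_eq _ X](cat_take_drop (q - p) (drop p s)) perm_cat2r.
by rewrite perm_rev.
Qed.

Lemma unfolded_order_perm F : perm_eq (unfolded_order F) (iota 0 (size F)).
Proof.
rewrite /unfolded_order; set L := [seq minn _ _ | _ <- _].
have : perm_eq (L, iota 0 (size F)).2 (iota 0 (size F)) by [].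
elim: [seq c.1 | c <- chords F] (L, _) => [|x s IH] st st_perm //=.
apply: IH; apply: perm_trans st_perm; apply: reverse_segment_perm; lia.
Qed.

Lemma sort_pairP (c : nat * nat) :
  ((sort_pair c).1 <= (sort_pair c).2)%N /\ (sort_pair c = c \/ sort_pair c = (c.2, c.1)).
Proof. by case: c => a b; rewrite /sort_pair /= ltbE; case: ltnP => /= h; split; lia || auto. Qed.

Lemma uncrossed_apart (c d : nat * nat) : (c.1 <= c.2)%N -> (d.1 <= d.2)%N -> uncrossed c d ->
  apart c.1 c.2 d.1 d.2 /\ apart d.1 d.2 c.1 c.2.
Proof. rewrite /uncrossed /apart !ltbE => h1 h2; case: ifP; lia. Qed.

(** Only positions in the list receive a page, so equal chords at two positions are
    treated as distinct ones. *)
Lemma two_pagesP cs up down : two_pages cs up down ->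
  exists m : nat -> bool,
    (forall k, (k < size cs)%N -> all (uncrossed (nth (0, 0)%N cs k)) (if m k then up else down)) /\
    (forall k l, (k < l)%N -> (l < size cs)%N -> m k = m l ->
       uncrossed (nth (0, 0)%N cs l) (nth (0, 0)%N cs k)).
Proof.
elim: cs up down => [|c cs IH] up down /=; first by exists predT; split.
case: ifP => [+ _|_]; case: ifP => // hc /IH[m [m1 m2]].
- exists (fun k => if k is k'.+1 then m k' else true); split=> [[|k] //= kl|].
    by have := m1 k kl; case: (m k) => //= /andP[].
  move=> [|k] [|l] //= kl ls; last by apply: m2.
  by move=> ml; have := m1 l ls; rewrite -ml /= => /andP[].
- exists (fun k => if k is k'.+1 then m k' else false); split=> [[|k] //= kl|].
    by have := m1 k kl; case: (m k) => //= /andP[].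
  move=> [|k] [|l] //= kl ls; last by apply: m2.
  by move=> ml; have := m1 l ls; rewrite -ml /= => /andP[].
Qed.

Section Drawable.
Variables (n : nat) (w : seq 'I_n.+1) (F : seq nat).
Hypotheses (dw : double_occurrence w) (wF : partners w F) (c1 : condition1 w).
Local Notation N := (size w).

(** The contact points of the letter x are those of any of its two passages, and its
    page is the one assigned to its even position. *)
Lemma drawable_realizable (R : realType) : drawable F -> realizable R w.
Proof.
rewrite /drawable wF.1; set G := unfolded_order F.
have Gperm : perm_eq G (iota 0 N) by rewrite -wF.1; exact: unfolded_order_perm.
have sG : size G = N by rewrite (perm_size Gperm) size_iota.
set J := [seq index_nat i G | i <- iota 0 N].
set E := [seq sort_pair (arch_ends J i) | i <- iota 0 N].
set cs := [seq nth _ E k.*2 | k <- _].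
have nth_J i : (i < N)%N -> nth 0%N J i = index i G.
  by move=> iN; rewrite (nth_map 0%N) ?size_iota // nth_iota // index_natE.
have nth_E i : (i < N)%N -> nth (0, 0)%N E i = sort_pair (arch_ends J i).
  by move=> iN; rewrite (nth_map 0%N) ?size_iota // nth_iota.
have memG i : (i < N)%N -> i \in G by rewrite (perm_mem Gperm) mem_iota.
have NE : N = (n.+1 * 2)%N by exact: size_double_occurrence.
move=> /and3P[/eqP lastG /allP same /two_pagesP[m [_ pages]]].
have posP x : (index x w < N)%N by rewrite index_mem -has_pred1 has_count dw.
(* The even one of the two positions of the letter x. *)
pose even_end x := if odd (index x w) then nth 0%N F (index x w) else index x w.
have even_endP x : [/\ (even_end x < N)%N, ~~ odd (even_end x) & w`[even_end x] = x].
  have := partner_parity dw wF c1 (posP x); rewrite /even_end.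
  case: ifP => hx hF; split; rewrite ?hx ?(partner_lt wF) ?(partner_letter wF) ?nth_index // -?index_mem //.
  by move: hF; rewrite oddD hx; case: odd.
have E_letter i j : (i < N)%N -> (j < N)%N -> w`[i] = w`[j] -> nth (0, 0)%N E i = nth (0, 0)%N E j.
  move=> iN jN /eqP; rewrite (partner_eq wF) // => /orP[/eqP -> //|/eqP ->].
  have := same j; rewrite mem_iota jN => /(_ erefl).
  by rewrite !eqnE -/(pair_eq _ _) => /eqP <-.
pose A x := (nth (0, 0)%N E (index x w)).1; pose B x := (nth (0, 0)%N E (index x w)).2.
have E_AB i : (i < N)%N -> nth (0, 0)%N E i = (A w`[i], B w`[i]).
  move=> iN; rewrite -surjective_pairing; apply: E_letter => //.
  by rewrite nth_index // mem_nth.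
have -> : w = [seq w`[i] | i <- iota 0 N] by rewrite -/(mkseq _ _) mkseq_nth.
apply: (@arch_diagram_realizable n.+1 N _ (nth 0%N J) A B (fun x => m (even_end x)./2)).
- by rewrite NE.
- by rewrite NE oddM andbF.
- by move=> i iN; rewrite nth_J // -sG index_mem memG.
- by move=> i j iN jN; rewrite !nth_J // => h; rewrite -(nth_index 0%N (memG i iN)) h nth_index ?memG.
- have N1 : (N.-1 < N)%N by rewrite NE.
  have nthG : nth 0%N G N.-1 = N.-1.
    by rewrite -[RHS]lastG (last_nth 0%N) sG -[in RHS](prednK (leq_ltn_trans (leq0n _) N1)).
  by rewrite nth_J // -[in LHS]nthG index_uniq ?sG // (perm_uniq Gperm) iota_uniq.
- move=> i iN; have := E_AB i iN; rewrite nth_E //.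
  have [_ [->|->]] := sort_pairP (arch_ends J i); rewrite /arch_ends; first by left.
  by case=> <- <-; right.
- move=> i j iN jN ij /eqP; rewrite (partner_eq wF) // (negbTE ij) => /eqP ->.
  by have := partner_parity dw wF c1 jN; rewrite oddD; case: odd; case: odd.
- move=> x y xy mxy.
  have [xN xo wx] := even_endP x; have [yN yo wy] := even_endP y.
  have nth_cs k : (k.*2 < N)%N -> (k < size cs)%N /\ nth (0, 0)%N cs k = nth (0, 0)%N E k.*2.
    move=> kN; have kN2 : (k < N./2)%N by have := oddM n.+1 2; rewrite -NE andbF => ho; move: ho kN; clear; lia.
    by rewrite /cs size_map size_iota (nth_map 0%N) ?size_iota // nth_iota.
  have xE : nth (0, 0)%N E (even_end x) = (A x, B x) by rewrite E_AB // wx.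
  have yE : nth (0, 0)%N E (even_end y) = (A y, B y) by rewrite E_AB // wy.
  have AB z : (A z <= B z)%N by rewrite /A /B nth_E //; case: (sort_pairP (arch_ends J (index z w))).
  have xk : even_end x = (even_end x)./2.*2 by rewrite -[LHS]odd_double_half (negbTE xo).
  have yk : even_end y = (even_end y)./2.*2 by rewrite -[LHS]odd_double_half (negbTE yo).
  have [xs xcs] := nth_cs (even_end x)./2 ltac:(by rewrite -xk).
  have [ys ycs] := nth_cs (even_end y)./2 ltac:(by rewrite -yk).
  rewrite -xk xE in xcs; rewrite -yk yE in ycs.
  have ne : even_end x <> even_end y by move=> h; move: xy; rewrite -wx -wy h eqxx.
  have [h|h|h] := ltngtP (even_end x)./2 (even_end y)./2; last by move: ne; rewrite xk yk h.
    have := pages _ _ h ys mxy; rewrite xcs ycs => /uncrossed_apart.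
    by case=> //=.
  by have := pages _ _ h xs (esym mxy); rewrite xcs ycs => /uncrossed_apart; case=> //=.
- by rewrite -/(mkseq _ _) mkseq_nth.
Qed.
End Drawable.

(** * Classification with nine chords *)

Lemma search_succeeds : search_diagrams 18.
Proof. by vm_cast_no_check (erefl true). Qed.

Lemma exceptional_wordE : exceptional_word = [seq inord k | k <- exceptional_letters].
Proof. by []. Qed.

Lemma exceptional_double_occurrence : double_occurrence exceptional_word.
Proof.
move=> i; rewrite exceptional_wordE count_map.
rewrite (@eq_in_count _ _ (pred1 (val i))) => [|k].
  by case: i => i; do 9! [case: i => [|i] //].
have /allP lt9 : all (fun k => k < 9)%N exceptional_letters by [].
by move=> /lt9 k9 /=; rewrite -(inj_eq val_inj) /= inordK.
Qed.

(** The word starts at position 13 here, where its chord lengths are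
    lexicographically least. *)
Lemma exceptional_partnersP : partners (rot 13 exceptional_word) exceptional_partners.
Proof.
have sz : size exceptional_word = 18 by rewrite size_map.
pose l i := exceptional_letter (i + 13).
have letterE i j : (i < 18)%N -> (j < 18)%N ->
    ((rot 13 exceptional_word)`[j] == (rot 13 exceptional_word)`[i]) = (l j == l i).
  move=> iN jN; rewrite !nth_rot ?sz // !exceptional_word_nth.
  by rewrite -(inj_eq val_inj) /= !inordK // exceptional_letter_lt.
have check : all (fun i => [&& (nth 0 exceptional_partners i < 18)%N,
    nth 0%N exceptional_partners i != i & all (fun j => (l j == l i) ==
      ((j == i) || (j == nth 0%N exceptional_partners i))) (iota 0 18)]) (iota 0 18).
  by vm_compute.
split; rewrite size_rot sz // => i iN.
have /and3P[h1 h2 /allP h3] := allP check i ltac:(by rewrite mem_iota); split=> // j jN.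
by rewrite letterE //; have := h3 j; rewrite mem_iota => /(_ jN)/eqP.
Qed.

Lemma exceptional_even_interlacement : even_interlacement exceptional_word.
Proof.
apply: even_interlacement_equiv (gauss_equiv_unrot 13 _) _.
have dr := rot_double_occurrence 13 exceptional_double_occurrence.
by apply/(conditionsP dr exceptional_partnersP); vm_compute.
Qed.

(** A canonical rotation of the word is reached by the search: its partner list is
    either the exceptional one or passes the planarity test. *)
Lemma realizable_or_exceptional (R : realType) (w : seq 'I_9) : double_occurrence w ->
  even_interlacement w -> realizable R w \/ gauss_equiv exceptional_word w.
Proof.
move=> dw ew; have [r [F [wF least]]] := canonical_rotation dw.
have drw := rot_double_occurrence r dw.
have erw := even_interlacement_equiv (gauss_equiv_rot r w) ew.
have := leaf_reached search_succeeds drw (size_double_occurrence drw) wF erw.1 least.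
rewrite /leaf least; have -> := (conditionsP drw wF).1 erw.
case: eqP => [FE _|_ /(drawable_realizable drw wF erw.1 R) rw]; last first.
  by left; exact: realizable_equiv (gauss_equiv_rot r w) rw.
right; have dr := rot_double_occurrence 13 exceptional_double_occurrence.
rewrite FE in wF; have [s sw] := same_partners dr drw exceptional_partnersP wF.
apply: gauss_equiv_trans (gauss_equiv_rot 13 _) _.
apply: gauss_equiv_trans (gauss_equiv_relabel s _) _.
by rewrite -sw; exact: gauss_equiv_unrot.
Qed.

Theorem mainTheorem2 (R : realType) :
  double_occurrence exceptional_word /\
  (forall w : seq 'I_9, double_occurrence w ->
     ([/\ condition1 w, condition2 w, condition3 w & ~ realizable R w]
        <-> gauss_equiv exceptional_word w)) /\
  ~ (forall (n : nat) (w : seq 'I_n), double_occurrence w ->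
       condition1 w -> condition2 w -> condition3 w -> realizable R w).
Proof.
have exc := exceptional_even_interlacement.
have nexc := @exceptional_not_realizable R.
split; first exact: exceptional_double_occurrence.
split=> [w dw|all_realizable]; last first.
  by apply: nexc; apply: all_realizable exceptional_double_occurrence exc.1 exc.2.1 exc.2.2.
split=> [[c1 c2 c3 nw]|ew].
  by have [] := realizable_or_exceptional R dw (conj c1 (conj c2 c3)).
have [c1 [c2 c3]] := even_interlacement_equiv ew exc.
by split=> // /(realizable_equiv ew).
Qed.
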